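(* Let $n\ge 2$, $p$ a prime, $b_1\in\mathbb{Z}_p$, and $V_n(\mathbb{Z}_p)_{a_1 = b_1} = \{x^n + a_1 x^{n - 1} + \ldots + a_n \in \mathbb{Z}_p[x] : a_1 = b_1\}$. Then \begin{align*} P^{\max}(V_n(\mathbb{Z}_p)_{a_1 = b_1}) &= \begin{cases} 1 & \text{if } (n, p) = (2, 2) \text{ and } 2 \nmid b_1, \\ 1/2 & \text{if } (n, p) = (2, 2) \text{ and } 2 \mid b_1, \\ 1 - 1/p^2 & \text{otherwise,} \end{cases} \\ P_0^{\mathrm{sqf}}(V_n(\mathbb{Z}_p)_{a_1 = b_1}) &= \begin{cases} 1 & \text{if } (n, p) = (2, 2) \text{ and } 2 \nmid b_1, \\ 0 & \text{if } (n, p) = (2, 2) \text{ and } 2 \mid b_1, \\ 1 - 1/p & \text{otherwise.} \end{cases} \end{align*} Moreover $P_1^{\mathrm{sqf}}(V_n(\mathbb{Z}_2)_{a_1 = b_1}) = 0$, and if $p$ is odd, then \[ P_1^{\mathrm{sqf}}(V_n(\mathbb{Z}_p)_{a_1 = b_1}) = \begin{cases} (p - 1)/p^2 & \text{if } n = 2, \\ \dfrac{(p - 1)^2}{p^2 (p + 1)} - \dfrac{(-1)^n (p - 1)^2}{p^n (p + 1)} + \dfrac{(-1)^n}{p^n} (p - 1) \iota_{n, p}(\overline{b_1}) & \text{if } n > 2, \end{cases} \] where for $b \in \mathbb{F}_p$, \[ \iota_{n, p}(b) = \frac{1}{p} \sum_{\chi \in \widehat{\mathbb{F}_p} \setminus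 \{1\}} \chi(b)^{-1} \sum_{c \in \mathbb{F}_p} \chi(c)^n = \begin{cases} 0 & \text{if } p \nmid n, \\ -1 & \text{if } p \mid n \text{ and } b \neq 0, \\ p - 1 & \text{if } p \mid n \text{ and } b = 0. \end{cases} \]
   Context: $V_n(\mathbb{Z}_p)$ is the set of monic degree-$n$ polynomials over $\mathbb{Z}_p$; the set $V_n(\mathbb{Z}_p)_{a_1=b_1}$ is identified with $\mathbb{Z}_p^{n-1}$ via $(a_2,\dots,a_n)$ with Haar measure. Densities are ratios of measures: $P_0^{\mathrm{sqf}}$ is the density of $f$ with $p\nmid\mathrm{Disc}(f)$, $P_1^{\mathrm{sqf}}$ the density of $f$ with $v_p(\mathrm{Disc}(f))=1$, and $P^{\max}$ the density of $f$ with $\mathbb{Z}_p[x]/(f(x))$ the maximal order of $\mathbb{Q}_p[x]/(f(x))$. $\overline{b_1}$ is the reduction of $b_1$ mod $p$, and $\widehat{\mathbb{F}_p}$ is the group of characters of the additive group $\mathbb{F}_p$, with $1$ the trivial character. *)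

(* Defs.v *)
From HB Require Import structures.
From mathcomp Require Import all_boot all_order all_algebra.
From mathcomp Require Import all_classical all_reals all_analysis.
From mathcomp Require Import qpoly complex.

Set Implicit Arguments.
Unset Strict Implicit.
Unset Printing Implicit Defensive.

Import Order.TTheory GRing.Theory Num.Theory.

Local Open Scope classical_set_scope.
Local Open Scope ring_scope.

(* The p-adic integers as the inverse limit of the rings Z/p^k: [x k] is the
   representative in [0, p^k) of the image of x in Z/p^k. *)
Record padic_int (p : nat) (p_pr : prime p) := PadicInt {
  padic_res :> nat -> int;
  padic_resP : forall k, padic_res k = (padic_res k.+1 %% (p ^ k)%N)%Z }.

Section PadicInt.
Variables (p : nat) (p_pr : prime p).
Local Notation Zp := (padic_int p_pr).
Implicit Types x y z : Zp.

HB.instance Definition _ := gen_eqMixin Zp.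
HB.instance Definition _ := gen_choiceMixin Zp.

Lemma padic_eqP x y : (forall k, x k = y k) -> x = y.
Proof.
case: x y => [x xP] [y yP] /= /funext xy; subst y.
by congr PadicInt; exact: Prop_irrelevance.
Qed.

Lemma padic_mod x k : (x k %% (p ^ k)%N)%Z = x k.
Proof. by rewrite [x k]padic_resP modz_mod. Qed.

Lemma modz_expS (a : int) k :
  ((a %% (p ^ k.+1)%N)%Z %% (p ^ k)%N)%Z = (a %% (p ^ k)%N)%Z.
Proof.
apply/eqP; rewrite eqz_mod_dvd.
apply: (@dvdz_trans (p ^ k.+1)%N%:Z); first by rewrite dvdzE /= expnS dvdn_mull.
by rewrite -eqz_mod_dvd modz_mod.
Qed.

Lemma padic_of_coherent (u : nat -> int) :
    (forall k, (u k %% (p ^ k)%N)%Z = (u k.+1 %% (p ^ k)%N)%Z) ->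
  forall k, (u k %% (p ^ k)%N)%Z =
    ((u k.+1 %% (p ^ k.+1)%N)%Z %% (p ^ k)%N)%Z.
Proof. by move=> uP k; rewrite modz_expS. Qed.

Definition padic_of (u : nat -> int)
    (uP : forall k, (u k %% (p ^ k)%N)%Z = (u k.+1 %% (p ^ k)%N)%Z) : Zp :=
  PadicInt p_pr (padic_of_coherent uP).

Lemma padic_const_subproof (a : int) k :
  (a %% (p ^ k)%N)%Z = (a %% (p ^ k)%N)%Z.
Proof. by []. Qed.

Lemma padic_opp_subproof x k :
  (- x k %% (p ^ k)%N)%Z = (- x k.+1 %% (p ^ k)%N)%Z.
Proof. by rewrite padic_resP modzNm. Qed.

Lemma padic_add_subproof x y k :
  ((x k + y k) %% (p ^ k)%N)%Z = ((x k.+1 + y k.+1) %% (p ^ k)%N)%Z.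
Proof. by rewrite !(padic_resP _ k) modzDm. Qed.

Lemma padic_mul_subproof x y k :
  ((x k * y k) %% (p ^ k)%N)%Z = ((x k.+1 * y k.+1) %% (p ^ k)%N)%Z.
Proof. by rewrite !(padic_resP _ k) modzMm. Qed.

Definition padic_zero : Zp := padic_of (padic_const_subproof 0).
Definition padic_one : Zp := padic_of (padic_const_subproof 1).
Definition padic_opp x : Zp := padic_of (padic_opp_subproof x).
Definition padic_add x y : Zp := padic_of (padic_add_subproof x y).
Definition padic_mul x y : Zp := padic_of (padic_mul_subproof x y).

Lemma padic_addA : associative padic_add.
Proof.
by move=> x y z; apply: padic_eqP => k /=; rewrite modzDml modzDmr addrA.
Qed.

Lemma padic_addC : commutative padic_add.
Proof. by move=> x y; apply: padic_eqP => k /=; rewrite addrC. Qed.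

Lemma padic_add0 : left_id padic_zero padic_add.
Proof.
by move=> x; apply: padic_eqP => k /=; rewrite mod0z add0r padic_mod.
Qed.

Lemma padic_addN : left_inverse padic_zero padic_opp padic_add.
Proof.
by move=> x; apply: padic_eqP => k /=; rewrite modzDml addNr.
Qed.

HB.instance Definition _ := GRing.isZmodule.Build Zp
  padic_addA padic_addC padic_add0 padic_addN.

Lemma padic_mulA : associative padic_mul.
Proof.
by move=> x y z; apply: padic_eqP => k /=; rewrite modzMml modzMmr mulrA.
Qed.

Lemma padic_mulC : commutative padic_mul.
Proof. by move=> x y; apply: padic_eqP => k /=; rewrite mulrC. Qed.

Lemma padic_mul1 : left_id padic_one padic_mul.
Proof.
by move=> x; apply: padic_eqP => k /=; rewrite modzMml mul1r padic_mod.
Qed.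

Lemma padic_mulD : left_distributive padic_mul padic_add.
Proof.
move=> x y z; apply: padic_eqP => k /=.
by rewrite modzMml modzDm mulrDl.
Qed.

Lemma padic_one_neq0 : padic_one != padic_zero.
Proof.
apply/eqP => /(congr1 (fun x : Zp => x 1)) /=.
by rewrite expn1 mod0z modz_small //= ltz_nat prime_gt1.
Qed.

HB.instance Definition _ := GRing.Zmodule_isComNzRing.Build Zp
  padic_mulA padic_mulC padic_mul1 padic_mulD padic_one_neq0.

(* The inverse is chosen classically; it is the identity on non-units. *)
Definition padic_unit : pred Zp := fun x => `[< exists y, y * x = 1 >].
Definition padic_inv x : Zp := xget x [set y | y * x = 1].

Lemma padic_mulVx : {in padic_unit, left_inverse 1 padic_inv *%R}.
Proof.
move=> x /asboolP xU; rewrite /padic_inv.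
by case: xgetP => [y _ //|]; case: xU => y yx /(_ y).
Qed.

Lemma padic_unitPl x y : y * x = 1 -> padic_unit x.
Proof. by move=> yx; apply/asboolP; exists y. Qed.

Lemma padic_inv_out : {in [predC padic_unit], padic_inv =1 id}.
Proof.
move=> x /asboolPn xNU; rewrite /padic_inv; case: xgetP => [y _ yx|//].
by case: xNU; exists y.
Qed.

HB.instance Definition _ := GRing.ComNzRing_hasMulInverse.Build Zp
  padic_mulVx padic_unitPl padic_inv_out.

Lemma padic_resD x a d : (x (a + d)%N %% (p ^ a)%N)%Z = x a.
Proof.
elim: d => [|d IHd]; first by rewrite addn0 padic_mod.
rewrite -[RHS]IHd addnS (padic_resP x (a + d)%N).
apply/eqP; rewrite eqz_mod_dvd -[X in (X %| _)%Z]/((p ^ a)%N%:Z).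
apply: (@dvdz_trans (p ^ (a + d))%N%:Z); first by rewrite dvdzE dvdn_exp2l // leq_addr.
by rewrite -eqz_mod_dvd modz_mod.
Qed.

Lemma padic_neq0 x : x != 0 -> exists k, x k != 0.
Proof.
move=> x0; apply: contrapT => xk; case/eqP: x0; apply: padic_eqP => k /=.
rewrite mod0z; apply/eqP; apply/negP => xk0; apply: xk; exists k.
exact/negP.
Qed.

Lemma padic_mul_eq0 : GRing.integral_domain_axiom Zp.
Proof.
move=> x y xy0; apply: contrapT => /negP; rewrite negb_or => /andP[x0 y0].
have [a xa] := padic_neq0 x0; have [b yb] := padic_neq0 y0.
have := congr1 (fun z : Zp => z (a + b)%N) xy0 => /=; rewrite mod0z => /dvdz_mod0P.
have ndvd (z : Zp) c d : z c != 0 -> ~~ (p ^ c %| `|z (c + d)%N|)%N.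
  apply: contra => zc; rewrite -(padic_resD z c d).
  by apply/eqP/dvdz_mod0P; rewrite dvdzE.
move: (ndvd x a b xa) (ndvd y b a yb); rewrite addnC dvdzE abszM /=.
set u := absz _; set v := absz _ => ua vb.
have u0 : (0 < u)%N by move: ua; case: (u) => //; rewrite dvdn0.
have v0 : (0 < v)%N by move: vb; case: (v) => //; rewrite dvdn0.
rewrite !pfactor_dvdn // ?muln_gt0 ?u0 // lognM // -?ltnNge in ua vb *.
rewrite leqNgt => /negP; apply.
by rewrite [X in (_ < X)%N]addnC -addSn leq_add // ltnW.
Qed.

HB.instance Definition _ := GRing.ComUnitRing_isIntegral.Build Zp padic_mul_eq0.

Definition padic_open : set (set Zp) :=
  [set U | forall x, U x -> exists k, forall y, y k = x k -> U y].

Lemma padic_openT : padic_open setT.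
Proof. by move=> x _; exists 0. Qed.

Lemma padic_openI : setI_closed padic_open.
Proof.
move=> U V oU oV x [Ux Vx].
have [k kU] := oU x Ux; have [l lV] := oV x Vx.
exists (k + l)%N => y yx; split.
  by apply: kU; rewrite -(padic_resD y k l) yx padic_resD.
by apply: lV; rewrite -(padic_resD y l k) addnC yx addnC padic_resD.
Qed.

Lemma padic_open_bigcup (I : Type) (f : I -> set Zp) :
  (forall i, padic_open (f i)) -> padic_open (\bigcup_i f i).
Proof.
move=> fo x [i _ fix_]; have [k kf] := fo i x fix_.
by exists k => y yx; exists i => //; exact: kf.
Qed.

HB.instance Definition _ := isPointed.Build Zp 0.
HB.instance Definition _ := isOpenTopological.Build Zp
  padic_openT padic_openI padic_open_bigcup.

End PadicInt.

Notation padic_num p_pr := {fraction padic_int p_pr}.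

Section Arithmetic.
Variables (p : nat) (p_pr : prime p).

Definition padic_dvd (k : nat) (x : padic_int p_pr) : Prop :=
  exists y, x = p%:R ^+ k * y.

Definition padic_val_eq (x : padic_int p_pr) (k : nat) : Prop :=
  padic_dvd k x /\ ~ padic_dvd k.+1 x.

(* x 1 is the representative of x modulo p. *)
Definition padic_modp (x : padic_int p_pr) : 'F_p := (x 1)%:~R.

End Arithmetic.

(* Used for f monic over a domain of characteristic 0, so that f^`() has degree
   (deg f) - 1 and no division by the leading coefficient is needed. *)
Definition disc (A : idomainType) (f : {poly A}) : A :=
  (-1) ^+ 'C((size f).-1, 2) * resultant f f^`().

Section Orders.
Variable (A : idomainType).
Local Notation K := {fraction A}.
Implicit Type B : comAlgType K.

(* An A-order of the K-algebra B: a subring which is a finitely generated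
   A-module and spans B over K. *)
Definition is_order B (S : set B) : Prop :=
  [/\ S 1,
      forall x y, S x -> S y -> S (x - y),
      forall x y, S x -> S y -> S (x * y) &
      exists s : seq B,
        S = [set \sum_(i < size s) tofrac (c i) *: s`_i | c in [set: nat -> A]] /\
        [set: B] = [set \sum_(i < size s) c i *: s`_i | c in [set: nat -> K]]].

(* In a commutative algebra the product of two orders is an order, so a maximal
   order is unique: it contains all the others. *)
Definition is_maximal_order B (S : set B) : Prop :=
  is_order S /\ forall T : set B, is_order T -> S `<=` T -> T = S.

Definition frac_poly (f : {poly A}) : {poly K} := map_poly (@tofrac A) f.

(* The subring A[x]/(f) of K[x]/(f), for f monic of positive degree. *)
Definition poly_order (f : {poly A}) : set {poly %/ (frac_poly f)} :=
  [set in_qpoly (frac_poly f) (frac_poly g) | g in [set: {poly A}]].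

End Orders.

Arguments poly_order {A} f _.

Section Density.
Variables (R : realType) (p : nat) (p_pr : prime p).
Local Notation Zp := (padic_int p_pr).

Definition borel_rV m := g_sigma_algebraType (@open 'rV[Zp]_m).

(* As Z_p^m is compact, finiteness on compact sets amounts to finiteness of the
   total mass; regularity is automatic. *)
Definition is_haar m (mu : {measure set (borel_rV m) -> \bar R}) : Prop :=
  [/\ (0 < mu setT)%E, (mu setT < +oo)%E &
      forall (v : 'rV[Zp]_m) (E : set (borel_rV m)),
        measurable E -> mu [set v + x | x in (E : set 'rV[Zp]_m)] = mu E].

(* The polynomial x^n + b1 x^(n-1) + a_2 x^(n-2) + ... + a_n, where the entry
   of index i of the row vector a is a_(i+2). *)
Definition monic_a1 n (b1 : Zp) (a : 'rV[Zp]_n.-1) : {poly Zp} :=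
  'X^n + b1 *: 'X^(n.-1) + (\sum_(i < n.-1) a ord0 i *: 'X^(n - i.+2)).

Definition density n (b1 : Zp) (mu : {measure set (borel_rV n.-1) -> \bar R})
    (Q : set {poly Zp}) : R :=
  fine (mu [set a | Q (monic_a1 b1 a)]) / fine (mu setT).

Definition P_max n b1 mu : R :=
  @density n b1 mu [set f | is_maximal_order (poly_order f)].

Definition P0_sqf n b1 mu : R :=
  @density n b1 mu [set f | ~ padic_dvd 1 (disc f)].

Definition P1_sqf n b1 mu : R :=
  @density n b1 mu [set f | padic_val_eq (disc f) 1].

End Density.

Arguments P_max {R p p_pr} n b1 mu.
Arguments P0_sqf {R p p_pr} n b1 mu.
Arguments P1_sqf {R p p_pr} n b1 mu.

Section Characters.
Variables (R : realType) (p : nat).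

(* Homomorphisms from the additive group F_p to the multiplicative group C^*;
   the two equations imply that chi does not vanish. *)
Definition add_char : set {ffun 'F_p -> R[i]} :=
  [set chi | chi 0 = 1 /\ forall x y, chi (x + y) = chi x * chi y].

Definition trivial_char : {ffun 'F_p -> R[i]} := [ffun => 1].

Definition iota_np (n : nat) (b : 'F_p) : R[i] :=
  p%:R^-1 * \sum_(chi \in add_char `\ trivial_char)
    ((chi b)^-1 * \sum_(c : 'F_p) chi c ^+ n).

End Characters.

(* Main.v *)
Require Import Defs.
From HB Require Import structures.
From mathcomp Require Import all_boot all_order all_algebra.
From mathcomp Require Import all_classical all_reals all_analysis.
From mathcomp Require Import qpoly complex separable cyclotomic finfield ring.

Set Implicit Arguments.
Unset Strict Implicit.
Unset Printing Implicit Defensive.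

Import Order.TTheory GRing.Theory Num.Theory.

Local Open Scope classical_set_scope.
Local Open Scope ring_scope.

(** Write an element of V_n(Z_p) with a_1 = b_1 modulo p^2 as f + p g, with f
    fixed by the reduction mod p and g arbitrary of degree < n - 1.  If m is the
    largest monic polynomial with m^2 | f mod p, and f = m^2 s + p t over Z_p,
    Dedekind's criterion says that Z_p[x]/(f + p g) is maximal if and only if no
    nonconstant d over F_p satisfies d^2 | f and d | t + g.  So P^max counts
    pairs (f, t) over F_p of this kind ("square-coprime"), and taking t = 0
    counts squarefree polynomials, that is P_0^sqf.

    Every pair (f, t) is uniquely (k^2 s, k t') with (s, t') square-coprime.
    Sorting all pairs by k gives a recursion for the number of square-coprime
    pairs with a prescribed next-to-leading coefficient; as a_1(k^2 s) =
    2 a_1(k) + a_1(s), its solution is equidistributed in a_1 if 2 <> 0 and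
    depends on a_1 only for n = 2 if 2 = 0.

    The valuation of the discriminant is that of the determinant of the Sylvester
    matrix of f and f'.  A vector of the kernel mod p, lifted and divided by p,
    replaces a row of that matrix and shows that the valuation is 1 exactly when
    gcd(f, f') has degree 1 mod p and the order is maximal.  This never happens
    for p = 2; for odd p it means f = (x - r)^2 g mod p with g squarefree and
    g(r) <> 0, and removing possible factors x - r from squarefree polynomials
    counts these g. *)

(** * Square-coprime pairs over a finite field *)

(** Splitting off k lowers the bound on t by deg k but the degree of f by 2 deg k, so the counts in
    the recursion have bounds on t that do not match their degrees. They are comparable because, for
    fixed f, the condition on t depends only on t modulo the largest m with m^2 | f, and deg m <=
    deg f / 2: the proportion of good t is the same for every bound at least deg f / 2, and it is
    unchanged when t is shifted. The second point also disposes of the correction t in Dedekind's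
    criterion, which varies with f in an uncontrolled way. The counting thus needs no factorization
    into irreducibles. The denominators p + 1 come from alternating geometric sums of ratio -1/p,
    produced by removing x - r repeatedly, and iota + 1 is the number of r in F_p with b + n r =
    0. *)

Section SquareCoprime.
Variable F : fieldType.
Implicit Types d f k l t : {poly F}.

Definition sqcoprime f t : bool :=
  `[< forall d, d ^+ 2 %| f -> d %| t -> (size d <= 1)%N >].

(** For t = 0, k is the largest polynomial whose square divides f; this instance is both the period
    in t and the m of Dedekind's criterion. *)
Definition sqkernel f t k : bool :=
  [&& k ^+ 2 %| f, k %| t & sqcoprime (f %/ k ^+ 2) (t %/ k)].

Lemma sqcoprimeP f t :
  reflect (forall d, d ^+ 2 %| f -> d %| t -> (size d <= 1)%N) (sqcoprime f t).
Proof. exact: asboolP. Qed.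

Lemma size_sqr k : k != 0 -> size (k ^+ 2) = (size k).-1.*2.+1.
Proof.
by move=> k0; rewrite -[LHS]prednK ?size_poly_gt0 ?expf_neq0 // size_exp muln2.
Qed.

(** A candidate k of maximal degree works: a nonconstant d violating square-coprimality of the
    quotients would make d k a larger candidate. *)
Lemma sqkernel_exists f t :
  f \is monic -> exists2 k, k \is monic & sqkernel f t k.
Proof.
move=> fm; have f0 := monic_neq0 fm.
pose P m := `[< exists k, [/\ k ^+ 2 %| f, k %| t & size k = m] >].
have exP : exists m, P m.
  by exists (size (1 : {poly F})); apply/asboolP; exists 1; rewrite expr1n !dvd1p.
have ubP m : P m -> (m <= size f)%N.
  move=> /asboolP[k [kf _ <-]]; apply: dvdp_leq => //.
  by apply: dvdp_trans kf; rewrite expr2 dvdp_mulIl.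
case: (ex_maxnP exP ubP) => m /asboolP[k [kf kt km]] maxm.
have k0 : k != 0 by apply: contraNneq f0 => k0; move: kf; rewrite k0 expr0n /= dvd0p.
have lk : (lead_coef k)^-1 != 0 by rewrite invr_eq0 lead_coef_eq0.
exists ((lead_coef k)^-1 *: k).
  by rewrite monicE lead_coefZ mulVf // lead_coef_eq0.
set k1 := _ *: k.
have k1k : k1 %= k by exact: eqp_scale.
have k10 : k1 != 0 by rewrite scale_poly_eq0 negb_or lk.
have k1f : k1 ^+ 2 %| f by rewrite (eqp_dvdl _ (eqp_exp 2 k1k)).
have k1t : k1 %| t by rewrite (eqp_dvdl _ k1k).
apply/and3P; split=> //; apply/sqcoprimeP => d dfk dtk.
have d0 : d != 0.
  apply: contraTneq dfk => ->; rewrite expr0n /= dvd0p.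
  by apply: contraNneq f0 => fk0; rewrite -(divpK k1f) fk0 mul0r.
have : P (size (d * k1)).
  apply/asboolP; exists (d * k1); split=> //.
    by rewrite exprMn -(divpK k1f) dvdp_mul2r // expf_neq0.
  by rewrite -(divpK k1t) dvdp_mul2r.
move=> /maxm; rewrite size_mul // (eqp_size k1k) km.
by rewrite -subn1 leq_subLR leq_add2r.
Qed.

(** With g = gcd(k, l), the quotient l / g is coprime to k / g; by Gauss its square divides f / k^2
    and it divides t / k, so it is constant. Hence k is largest for divisibility and not only for
    degree, which gives uniqueness. *)
Lemma sqkernel_max f t k l : f != 0 ->
  sqkernel f t k -> l ^+ 2 %| f -> l %| t -> l %| k.
Proof.
move=> f0 /and3P[kf kt /sqcoprimeP kmax] lf lt.
have k0 : k != 0 by apply: contraNneq f0 => k0; move: kf; rewrite k0 expr0n /= dvd0p.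
pose g := gcdp k l.
have g0 : g != 0 by rewrite gcdp_eq0 (negPf k0).
have gk : g %| k by rewrite dvdp_gcdl.
have gl : g %| l by rewrite dvdp_gcdr.
have cop : coprimep (l %/ g) (k %/ g).
  by rewrite coprimep_sym; apply: coprimep_div_gcd; rewrite k0.
have sl : (size (l %/ g)%R <= 1)%N.
  apply: kmax.
    have : (l %/ g) ^+ 2 %| (f %/ k ^+ 2) * (k %/ g) ^+ 2.
      rewrite -(dvdp_mul2r _ _ (expf_neq0 2 g0)) -exprMn divpK //.
      by rewrite -mulrA -exprMn !divpK.
    by rewrite Gauss_dvdpl // coprimep_expl // coprimep_expr.
  have : l %/ g %| (t %/ k) * (k %/ g).
    by rewrite -(dvdp_mul2r _ _ g0) -mulrA !divpK.
  by rewrite Gauss_dvdpl.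
have /eqP sl1 : size (l %/ g)%R == 1%N.
  rewrite eqn_leq sl lt0n size_poly_eq0 divp_eq0 !negb_or g0 /=.
  have l0 : l != 0 by apply: contraNneq f0 => l0; move: lf; rewrite l0 expr0n /= dvd0p.
  by rewrite l0 -leqNgt dvdp_leq.
rewrite -(divpK gl).
have /size_poly1P[c c0 ->] : size (l %/ g)%R == 1%N by rewrite sl1.
by rewrite mul_polyC dvdpZl.
Qed.

Lemma sqkernel_uniq f t k l : f != 0 -> k \is monic -> l \is monic ->
  sqkernel f t k -> sqkernel f t l -> k = l.
Proof.
move=> f0 km lm kk ll; apply/eqP; rewrite -eqp_monic //; apply/andP; split.
  by case/and3P: (kk) => kf kt _; apply: sqkernel_max ll _ _.
by case/and3P: (ll) => lf lt _; apply: sqkernel_max kk _ _.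
Qed.

End SquareCoprime.

(** * Sums over monic polynomials with prescribed next-to-leading coefficient *)

Section MonicSums.
Variable F : finFieldType.
Implicit Types d f k l t s : {poly F}.
Local Notation q := #|F|.

Definition polys N : seq {poly F} := [seq val t | t : {poly_N F}].
Definition monics n : seq {poly F} := [seq 'X^n + t | t <- polys n].

(* The coefficient of [f] just below the leading one; it is 0 for [f] constant. *)
Definition nextc f : F := (f * 'X)`_(size f).-1.

Lemma mem_polys N t : (t \in polys N) = (size t <= N)%N.
Proof.
apply/mapP/idP => [[u _ ->]|tN]; first exact: size_npoly.
by exists (npolyp N t); [rewrite mem_enum | apply/esym/npolypK].
Qed.

Lemma polys_uniq N : uniq (polys N).
Proof. by rewrite map_inj_uniq ?enum_uniq //; exact: val_inj. Qed.

Lemma size_polys N : size (polys N) = (q ^ N)%N.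
Proof. by rewrite size_map -cardE card_npoly. Qed.

Lemma mem_monics n f : (f \in monics n) = (f \is monic) && (size f == n.+1).
Proof.
apply/mapP/andP => [[t + ->]|[fm /eqP fn]].
  rewrite mem_polys => tn; have ltn : (size t < size ('X^n : {poly F}))%N.
    by rewrite size_polyXn ltnS.
  by rewrite monicE lead_coefDl // lead_coefXn eqxx size_polyDl // size_polyXn.
exists (f - 'X^n); last by rewrite subrKC.
rewrite mem_polys; apply/leq_sizeP => j; rewrite leq_eqVlt coefB coefXn.
case/orP=> [/eqP <-|nj].
  by move: fm; rewrite monicE lead_coefE fn /= => /eqP ->; rewrite eqxx subrr.
by rewrite nth_default ?fn // gtn_eqF // subrr.
Qed.

Lemma monics_uniq n : uniq (monics n).
Proof. by rewrite map_inj_uniq ?polys_uniq //; exact: addrI. Qed.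

Lemma monicsP n f : reflect (f \is monic /\ size f = n.+1) (f \in monics n).
Proof. by rewrite mem_monics; apply: (iffP andP) => -[? /eqP]. Qed.

Lemma size_monics n : size (monics n) = (q ^ n)%N.
Proof. by rewrite size_map size_polys. Qed.

Lemma monics0 : monics 0 = [:: 1].
Proof.
have := size_monics 0; rewrite expn0; case E: (monics 0) => [|x [|]] // _.
have : 1 \in monics 0 by rewrite mem_monics monic1 size_poly1.
by rewrite E inE => /eqP <-.
Qed.

Lemma nextc1 : nextc 1 = 0.
Proof. by rewrite /nextc size_poly1 mul1r coefX. Qed.

Lemma nextcE n f : size f = n.+2 -> nextc f = f`_n.
Proof. by rewrite /nextc => ->; rewrite coefMX. Qed.

Lemma nextcXsubC c : nextc ('X - c%:P) = - c.
Proof. by rewrite (@nextcE 0) ?size_XsubC // coefB coefX coefC sub0r. Qed.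

(** For f = X^i + g and s = X^j + r, only X^i r X and X^j g X contribute to the coefficient i + j of
    f s X. The factor X in [nextc] makes this cover constant factors too. *)
Lemma nextcM f s : f \is monic -> s \is monic ->
  nextc (f * s) = nextc f + nextc s.
Proof.
move=> fm sm; rewrite /nextc size_monicM ?monic_neq0 //.
case Ef : (size f) => [|i].
  by move/eqP: Ef; rewrite size_poly_eq0 (negPf (monic_neq0 fm)).
case Es : (size s) => [|j].
  by move/eqP: Es; rewrite size_poly_eq0 (negPf (monic_neq0 sm)).
have [g gi Ef'] : exists2 g : {poly F}, (size g <= i)%N & f = 'X^i + g.
  have /mapP[t] : f \in monics i by rewrite mem_monics fm Ef eqxx.
  by rewrite mem_polys; exists t.
have [r rj Es'] : exists2 r : {poly F}, (size r <= j)%N & s = 'X^j + r.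
  have /mapP[t] : s \in monics j by rewrite mem_monics sm Es eqxx.
  by rewrite mem_polys; exists t.
rewrite {f fm Ef}Ef' {s sm Es}Es' addSn addnS /= !mulrDl !mulrDr !mulrDl -!exprSr -exprD.
rewrite -exprSr !coefD !coefXn !(ltn_eqF (ltnSn _)) !add0r.
rewrite -['X^i * r * 'X]mulrA coefXnM ltnNge leq_addr addKn /=.
rewrite (mulrC g 'X^j) -['X^j * g * 'X]mulrA coefXnM ltnNge leq_addl addnK /=.
rewrite [(g * r * 'X)`_ _]nth_default ?addr0 1?addrC //.
have [->|g0] := eqVneq g 0; first by rewrite !mul0r size_poly0.
have [->|r0] := eqVneq r 0; first by rewrite mulr0 mul0r size_poly0.
rewrite size_mulX ?mulf_neq0 // size_mul // prednK ?leq_add //.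
by rewrite addn_gt0 size_poly_gt0 g0.
Qed.

Lemma perm_monics_dvd k n j : k \in monics j -> (j <= n)%N ->
  perm_eq [seq f <- monics n | k %| f] [seq k * s | s <- monics (n - j)].
Proof.
case/monicsP => km kj jn; have k0 := monic_neq0 km.
apply: uniq_perm; first by rewrite filter_uniq ?monics_uniq.
  by rewrite map_inj_uniq ?monics_uniq //; exact: mulfI.
move=> f; rewrite mem_filter; apply/andP/mapP => [[kf /monicsP[fm fn]]|[s + ->]].
  exists (f %/ k); last by rewrite mulrC divpK.
  rewrite mem_monics -(monicMr _ km) divpK // fm /= size_divp //.
  by rewrite fn kj /= subSn.
case/monicsP => sm sn; split; first exact: dvdp_mulIl.
by rewrite mem_monics monicMl // sm size_monicM ?monic_neq0 // kj sn addSn /= addnS subnKC.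
Qed.

Lemma perm_polys_dvd k N j : k \in monics j ->
  perm_eq [seq t <- polys N | k %| t] [seq k * s | s <- polys (N - j)].
Proof.
case/monicsP => km kj; have k0 := monic_neq0 km.
apply: uniq_perm; first by rewrite filter_uniq ?polys_uniq.
  by rewrite map_inj_uniq ?polys_uniq //; exact: mulfI.
move=> f; rewrite mem_filter; apply/andP/mapP => [[kf fN]|[s + ->]].
  exists (f %/ k); last by rewrite mulrC divpK.
  by move: fN; rewrite !mem_polys size_divp // kj /=; apply: leq_sub2r.
rewrite !mem_polys => sN; split; first exact: dvdp_mulIl.
have [->|s0] := eqVneq s 0; first by rewrite mulr0 size_poly0.
rewrite size_mul // kj addSn /= -(@subnKC j N) ?leq_add2l //.
rewrite leqNgt; apply: contra s0 => /ltnW Nj.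
by rewrite -size_poly_leq0 (leq_trans sN) // leq_subLR addn0.
Qed.

Variable V : nmodType.

Lemma sum_monics_dvd (E : {poly F} -> V) k n j :
    k \in monics j -> (j <= n)%N ->
  \sum_(f <- monics n | k %| f) E f = \sum_(s <- monics (n - j)) E (k * s).
Proof.
by move=> kj jn; rewrite -big_filter (perm_big _ (perm_monics_dvd kj jn)) big_map.
Qed.

Lemma sum_polys_dvd (E : {poly F} -> V) k N j : k \in monics j ->
  \sum_(t <- polys N | k %| t) E t = \sum_(s <- polys (N - j)) E (k * s).
Proof.
by move=> kj; rewrite -big_filter (perm_big _ (perm_polys_dvd N kj)) big_map.
Qed.

Lemma sum_monics_nextc (E : {poly F} -> V) n b :
  \sum_(f <- monics n.+1 | nextc f == b) E f =
  \sum_(t <- polys n) E ('X^(n.+1) + (b *: 'X^n + t)).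
Proof.
pose g (t : {poly F}) : {poly F} := 'X^(n.+1) + (b *: 'X^n + t).
rewrite -big_filter -[RHS](big_map g xpredT E); apply: perm_big.
apply: uniq_perm; first by rewrite filter_uniq ?monics_uniq.
  by rewrite map_inj_uniq ?polys_uniq // => s t /addrI /addrI.
move=> f; rewrite mem_filter; apply/andP/mapP => [[/eqP fb]|[t + ->]].
  case/mapP=> t; rewrite mem_polys => tn ft.
  exists (t - b *: 'X^n); last by rewrite /g ft subrKC.
  rewrite mem_polys; apply/leq_sizeP => j; rewrite leq_eqVlt => /orP[/eqP <-|nj].
    rewrite coefB coefZ coefXn eqxx mulr1 -fb (@nextcE n).
      by rewrite ft coefD coefXn (ltn_eqF (ltnSn n)) add0r subrr.
    by rewrite ft size_polyDl size_polyXn // ltnS.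
  by rewrite coefB coefZ coefXn gtn_eqF // mulr0 nth_default ?subrr // (leq_trans tn).
rewrite mem_polys => tn.
have bt : (size (b *: 'X^n + t)%R <= n.+1)%N.
  rewrite (leq_trans (size_polyD _ _)) // geq_max (leq_trans tn) // andbT.
  by rewrite (leq_trans (size_scale_leq _ _)) // size_polyXn.
split; last by apply/mapP; exists (b *: 'X^n + t) => //; rewrite mem_polys.
rewrite (@nextcE n); last by rewrite size_polyDl size_polyXn // ltnS.
rewrite !coefD coefZ !coefXn (ltn_eqF (ltnSn n)) eqxx add0r mulr1.
by rewrite [t`_n]nth_default // addr0.
Qed.

End MonicSums.

(** * Sorting pairs by their square part *)

Section SquareDecomposition.
Variables (F : finFieldType) (K : numFieldType).
Implicit Types d f k l t s : {poly F}.
Local Notation q := (#|F|%:R : K).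

Definition sqcount N n (b : F) : K :=
  \sum_(f <- monics F n | nextc f == b) \sum_(t <- polys F N | sqcoprime f t) 1.

Lemma sum_polys1 N : \sum_(t <- polys F N) (1 : K) = q ^+ N.
Proof. by rewrite big_const_seq count_predT size_polys iter_addr_0 natrX. Qed.

Lemma sum_monics1 n : \sum_(t <- monics F n) (1 : K) = q ^+ n.
Proof. by rewrite big_const_seq count_predT size_monics iter_addr_0 natrX. Qed.

(** The monic [sqkernel] exists and is unique, and its square divides f, whence the bound n / 2 on
    its degree. *)
Lemma sum_sqkernel n f t : f \in monics F n ->
  \sum_(j < n./2.+1) \sum_(k <- monics F j | sqkernel f t k) (1 : K) = 1.
Proof.
case/monicsP=> fm fn; have f0 := monic_neq0 fm.
have [k km kk] := sqkernel_exists t fm.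
have k0 := monic_neq0 km.
have sk : size k = (size k).-1.+1 by rewrite prednK // size_poly_gt0.
have jn : ((size k).-1 < n./2.+1)%N.
  case/and3P: kk => /(dvdp_leq f0) + _ _; rewrite fn.
  by rewrite size_sqr // !ltnS geq_half_double.
rewrite (bigD1 (Ordinal jn)) //= [X in _ + X]big1 ?addr0 => [|j jk]; last first.
  rewrite big_seq_cond big_pred0 // => l; apply/negP => /andP[/monicsP[lm lj] ll].
  case/eqP: jk; apply/val_inj => /=.
  by rewrite -(sqkernel_uniq f0 lm km ll kk) lj.
rewrite (big_rem k) /=; last by rewrite mem_monics km -sk eqxx.
rewrite kk big_seq_cond big_pred0 ?addr0 // => l; apply/negP => /andP[+ ll].
rewrite (rem_filter _ (monics_uniq _ _)) mem_filter => /andP[/= /eqP lk /monicsP[lm _]].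
by apply: lk; exact: sqkernel_uniq ll kk.
Qed.

(* Each pair (f, t) is counted once, at its [sqkernel] k; note the truncated
   subtraction [N - j], which is right because k | t and size t <= N < size k
   force t = 0. *)
Lemma sqcount_decomposition N n b :
  \sum_(f <- monics F n | nextc f == b) \sum_(t <- polys F N) (1 : K) =
  \sum_(j < n./2.+1) \sum_(k <- monics F j)
    sqcount (N - j) (n - j.*2) (b - nextc k *+ 2).
Proof.
transitivity (\sum_(f <- monics F n | nextc f == b) \sum_(t <- polys F N)
    \sum_(j < n./2.+1) \sum_(k <- monics F j | sqkernel f t k) (1 : K)).
  rewrite big_seq_cond [RHS]big_seq_cond; apply: eq_bigr => f /andP[fn _].
  by apply: eq_bigr => t _; rewrite sum_sqkernel.
under eq_bigr => f _ do rewrite exchange_big.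
rewrite exchange_big; apply: eq_bigr => -[j /= jn] _.
under eq_bigr => f _ do under eq_bigr => t _ do rewrite big_mkcond.
under eq_bigr => f _ do rewrite exchange_big.
rewrite exchange_big; apply: eq_big_seq => k kj.
have k2 : k ^+ 2 \in monics F j.*2.
  by case/monicsP: (kj) => km ks; rewrite mem_monics monic_exp // size_sqr ?monic_neq0 // ks /=.
have [km _] := monicsP _ _ kj; have k0 := monic_neq0 km.
transitivity (\sum_(f <- monics F n | k ^+ 2 %| f)
   if nextc f == b then \sum_(t <- polys F N | k %| t)
      (if sqcoprime (f %/ k ^+ 2) (t %/ k) then 1 else 0) else (0 : K)).
  rewrite big_mkcond [RHS]big_mkcond; apply: eq_bigr => f _.
  case: eqP => [_|_]; last by rewrite if_same.
  case: ifP => kf; last first.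
    by rewrite big1 // => t _; rewrite /sqkernel kf.
  rewrite [RHS]big_mkcond; apply: eq_bigr => t _; rewrite /sqkernel kf /=.
  by case: (k %| t).
rewrite (sum_monics_dvd _ k2); last by rewrite -geq_half_double -ltnS.
rewrite /sqcount [RHS]big_mkcond; apply: eq_big_seq => s /monicsP[sm _].
rewrite nextcM ?monic_exp // expr2 nextcM // -mulr2n addrC eq_sym -subr_eq eq_sym.
case: ifP => // _; rewrite (sum_polys_dvd _ _ kj) [RHS]big_mkcond.
by apply: eq_bigr => t _; rewrite !(mulrC _ s) !(mulrC _ t) !mulpK ?mulf_neq0.
Qed.

End SquareDecomposition.

(* The recursion is used with x = 1 for t = 0 and with x = 1/q for the number of
   square-coprime pairs divided by the number of t. *)
Section SquareRecursion.
Variables (F : finFieldType) (K : numFieldType).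
Implicit Types d f k l t s : {poly F}.
Local Notation q := (#|F|%:R : K).

Lemma card_neq0 : q != 0.
Proof. by rewrite pnatr_eq0 -lt0n; apply/card_gt0P; exists 0. Qed.

Lemma sum_monicsS_nextc (E : F -> K) n :
  \sum_(k <- monics F n.+1) E (nextc k) = q ^+ n * \sum_c E c.
Proof.
rewrite (partition_big (@nextc F) xpredT) //= mulr_sumr; apply: eq_bigr => c _.
rewrite (eq_bigr (fun=> 1 * E c)) => [|k /eqP ->]; last by rewrite mul1r.
by rewrite -mulr_suml sum_monics_nextc sum_polys1.
Qed.

Variables (x : K) (g : nat -> F -> K).
Hypothesis g0 : forall b, g 0 b = (b == 0)%:R.
Hypothesis gE : forall n b, q ^+ n = \sum_(j < n.+1./2.+1)
  x ^+ j * \sum_(k <- monics F j) g (n.+1 - j.*2) (b - nextc k *+ 2).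

Let gS n b : q ^+ n.+1 = g n.+2 b + \sum_(j < n./2.+1)
  x ^+ j.+1 * \sum_(k <- monics F j.+1) g (n - j.*2) (b - nextc k *+ 2).
Proof.
rewrite (gE _ b) big_ord_recl expr0 mul1r subn0 monics0 big_seq1 nextc1.
by rewrite mul0rn subr0.
Qed.

(** The total T m of g m over all b satisfies q^m = sum_j (x q)^j T (m - 2 j). In the recursion for
    g n.+2 b, the terms with deg k >= 1 run evenly through the values b - 2 c, because 2 is
    invertible; they therefore involve only totals, and that identity for m = n sums them to x
    q^n. *)
Lemma square_recursion_odd n b : (2 : F) != 0 ->
  g n.+2 b = q ^+ n.+1 - x * q ^+ n.
Proof.
move=> F2; pose T m := \sum_b g m b.
have sumT m c : \sum_b g m (b - c) = T m.
  rewrite [RHS](reindex_inj (addIr (- c))) //.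
have TE m : q ^+ m = \sum_(j < m./2.+1) (x * q) ^+ j * T (m - j.*2)%N.
  case: m => [|m].
    rewrite big_ord1 mul1r /T (eq_bigr _ (fun b _ => g0 b)).
    by rewrite (bigD1 0) //= eqxx big1 ?addr0 // => b' /negPf ->.
  have -> : q ^+ m.+1 = \sum_(b : F) q ^+ m.
    by rewrite sumr_const exprS mulr_natl.
  rewrite (eq_bigr _ (fun b _ => gE m b)) exchange_big; apply: eq_bigr => j _.
  rewrite -mulr_sumr exchange_big /= exprMn -mulrA; congr (_ * _).
  rewrite (eq_bigr (fun=> 1 * T (m.+1 - j.*2)%N)) => [|k _].
    by rewrite -mulr_suml sum_monics1.
  by rewrite mul1r sumT.
apply/eqP; rewrite (gS n b) eq_sym subr_eq; apply/eqP; congr (_ + _).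
rewrite TE mulr_sumr; apply: eq_bigr => j _.
rewrite exprS -!mulrA exprMn -mulrA; congr (_ * (_ * _)).
rewrite (sum_monicsS_nextc (fun c => g (n - j.*2) (b - c *+ 2))); congr (_ * _).
rewrite /T [RHS](reindex_inj (subrI b)) /= [RHS](reindex_inj (mulIf F2)) /=.
by apply: eq_bigr => c _; rewrite mulr_natr.
Qed.

(** The shift by 2 [nextc k] disappears, so the terms with deg k >= 1 are x q times the recursion
    for degree n at the same b. In degree 0 there is only the initial value g 0 b, and this is where
    b survives. *)
Lemma square_recursion_even n b : (2 : F) = 0 ->
  g n.+2 b = q ^+ n.+1 - x * q * (if n is m.+1 then q ^+ m else (b == 0)%:R).
Proof.
move=> F2.
have nextc2 k : b - nextc k *+ 2 = b by rewrite -mulr_natr F2 mulr0 subr0.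
have sumg m j : \sum_(k <- monics F j) g m (b - nextc k *+ 2) = q ^+ j * g m b.
  rewrite (eq_bigr (fun=> 1 * g m b)) => [|k _]; last by rewrite nextc2 mul1r.
  by rewrite -mulr_suml sum_monics1.
apply/eqP; rewrite (gS n b) eq_sym subr_eq; apply/eqP; congr (_ + _).
transitivity (x * q * \sum_(j < n./2.+1) (x * q) ^+ j * g (n - j.*2)%N b).
  rewrite mulr_sumr; apply: eq_bigr => j _.
  by rewrite sumg mulrA -exprMn exprS !mulrA.
congr (_ * _); case: n => [|n]; first by rewrite big_ord1 mul1r g0.
rewrite (gE n b); apply: eq_bigr => j _.
by rewrite sumg mulrA exprMn.
Qed.

End SquareRecursion.

(** * Sums of functions periodic modulo a monic polynomial *)

Section PeriodicSums.
Variables (F : finFieldType) (V : nmodType) (m : {poly F}) (d : nat).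
Hypothesis md : m \in monics F d.
Variable E : {poly F} -> V.
Hypothesis E_mod : forall a t, E (a * m + t) = E t.

(** The polynomials of degree less than d represent the residues modulo m, and translation by c
    permutes these. *)
Lemma sum_polys_shift c : \sum_(r <- polys F d) E (c + r) = \sum_(r <- polys F d) E r.
Proof.
have [mm ms] := monicsP _ _ md; have m0 := monic_neq0 mm.
have Emodp t : E (t %% m) = E t by rewrite [in RHS](divp_eq t m) E_mod.
under eq_bigr do rewrite -Emodp.
rewrite -(big_map (fun r => (c + r) %% m) xpredT E); apply: perm_big.
apply: uniq_perm.
- rewrite map_inj_in_uniq ?polys_uniq // => r s; rewrite !mem_polys => rd sd.
  by rewrite !modpD => /addrI; rewrite !modp_small ?ms.
- exact: polys_uniq.
move=> r; rewrite mem_polys; apply/mapP/idP => [[s _ ->]|rd].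
  by rewrite -ltnS -ms ltn_modp.
exists ((r - c) %% m); first by rewrite mem_polys -ltnS -ms ltn_modp.
by rewrite modpD modp_id -modpD subrKC modp_small // ms.
Qed.

Lemma sum_polys_split N : (d <= N)%N ->
  \sum_(t <- polys F N) E t = (\sum_(r <- polys F d) E r) *+ (#|F| ^ (N - d)).
Proof.
have [mm ms] := monicsP _ _ md; have m0 := monic_neq0 mm => dN.
transitivity (\sum_(r <- polys F d) \sum_(a <- polys F (N - d)) E (a * m + r)).
  transitivity (\sum_(t <- [seq a * m + r | r <- polys F d, a <- polys F (N - d)]) E t).
    apply: perm_big.
    apply: uniq_perm; first exact: polys_uniq.
      rewrite allpairs_uniq ?polys_uniq // => -[r a] [s b] /allpairsPdep /=.
      case=> [r' [a' [+ _ [-> ->]]]] /allpairsPdep[s' [b' [+ _ [-> ->]]]].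
      rewrite !mem_polys => rd sd E1.
      rewrite -ltnS -ms in rd; rewrite -ltnS -ms in sd.
      have := congr1 (fun u => u %/ m) E1; rewrite !divp_addl_mul_small // => ->.
      by have := congr1 (fun u => u %% m) E1; rewrite !modp_addl_mul_small // => ->.
    move=> t; rewrite mem_polys; apply/idP/allpairsPdep => [tN|[r [a [+ + ->]]]].
      exists (t %% m), (t %/ m); split; rewrite -?divp_eq // mem_polys.
        by rewrite -ltnS -ms ltn_modp.
      by rewrite size_divp // ms leq_sub2r.
    rewrite !mem_polys => rd ad; rewrite (leq_trans (size_polyD _ _)) // geq_max.
    rewrite (leq_trans rd) // andbT (leq_trans (size_polyMleq _ _)) // ms addnS /=.
    by rewrite -(leq_add2r d) subnK in ad.
  by rewrite big_allpairs_dep.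
rewrite -sumrMnl; apply: eq_bigr => r _.
under eq_bigr do rewrite E_mod.
by rewrite big_const_seq count_predT size_polys iter_addr_0.
Qed.

End PeriodicSums.

Lemma sum_polys_periodic (F : finFieldType) (V : nmodType) (m : {poly F}) d
    (E : {poly F} -> V) N c :
    m \in monics F d -> (forall a t, E (a * m + t) = E t) -> (d <= N)%N ->
  \sum_(t <- polys F N) E (c + t) = (\sum_(r <- polys F d) E r) *+ (#|F| ^ (N - d)).
Proof.
move=> md E_mod dN; rewrite -(sum_polys_shift md E_mod c).
by rewrite (sum_polys_split (E := fun t => E (c + t)) md) // => a t; rewrite addrCA E_mod.
Qed.

(** * Numbers of square-coprime pairs and of squarefree polynomials *)

Section SquareCounts.
Variables (F : finFieldType) (K : numFieldType).
Implicit Types (d f k l t s : {poly F}) (b : F).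
Local Notation q := (#|F|%:R : K).

Let half_leq n : (n./2 <= n)%N.
Proof. by rewrite -divn2 leq_div. Qed.

Lemma sum_sqcount N n b :
  \sum_(j < n.+1./2.+1) \sum_(k <- monics F j)
    sqcount K (N - j) (n.+1 - j.*2) (b - nextc k *+ 2) = q ^+ (N + n).
Proof.
rewrite -sqcount_decomposition sum_monics_nextc.
rewrite (eq_bigr (fun=> 1 * q ^+ N)) => [|t _]; last by rewrite mul1r sum_polys1.
by rewrite -mulr_suml sum_polys1 -exprD addnC.
Qed.

Lemma sqcount_deg0 N b : sqcount K N 0 b = q ^+ N * (b == 0)%:R.
Proof.
rewrite /sqcount monics0 big_mkcond big_seq1 nextc1 eq_sym.
case: eqP => _; rewrite ?mulr0 // mulr1 -(sum_polys1 F K) big_mkcond.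
apply: eq_bigr => t _; case: sqcoprimeP => // -[] d d1 _.
have := dvdp_leq (oner_neq0 _) (dvdp_trans (dvdp_mulIl d d) d1).
by rewrite size_poly1.
Qed.

(** Every d with d^2 | f divides m, so it divides a m + t exactly when it divides t. *)
Lemma sqkernel_periodic f m a t : f != 0 -> sqkernel f 0 m ->
  sqcoprime f (a * m + t) = sqcoprime f t.
Proof.
move=> f0 fm; have dm d : d ^+ 2 %| f -> d %| a * m.
  by move=> df; rewrite dvdp_mull // (sqkernel_max f0 fm) ?dvdp0.
by apply/sqcoprimeP/sqcoprimeP => h d df dt; apply: (h d df);
  [rewrite dvdp_add ?dm|rewrite -(dvdp_addr _ (dm d df))].
Qed.

Lemma sqkernel_monics f t m n : f \in monics F n -> m \is monic -> sqkernel f t m ->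
  exists2 d, m \in monics F d & (d <= n./2)%N.
Proof.
move=> /monicsP[fm fn] mm /and3P[mf _ _]; have m0 := monic_neq0 mm.
exists (size m).-1; first by rewrite mem_monics mm prednK ?size_poly_gt0 ?eqxx.
by have := dvdp_leq (monic_neq0 fm) mf; rewrite size_sqr // fn ltnS geq_half_double.
Qed.

Lemma sum_sqcoprime_shift f c n N M :
    f \in monics F n -> (n./2 <= N)%N -> (n./2 <= M)%N ->
  q ^+ M * \sum_(t <- polys F N | sqcoprime f (c + t)) 1 =
  q ^+ N * \sum_(t <- polys F M | sqcoprime f t) (1 : K).
Proof.
move=> fn nN nM; have [fm fs] := monicsP _ _ fn; have f0 := monic_neq0 fm.
have [m mm fk] := sqkernel_exists 0 fm.
have [d md dn] := sqkernel_monics fn mm fk.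
pose E t : K := if sqcoprime f t then 1 else 0.
have E_mod a t : E (a * m + t) = E t by rewrite /E sqkernel_periodic.
rewrite big_mkcond [in RHS]big_mkcond.
rewrite (sum_polys_periodic (E := E) c md) ?(leq_trans dn) //.
rewrite (sum_polys_split md E_mod (leq_trans dn nM)).
rewrite -[X in _ * X]mulr_natr -[X in _ = _ * X]mulr_natr !natrX.
rewrite mulrCA -exprD [RHS]mulrCA -exprD; congr (_ * q ^+ _).
by rewrite addnBA ?(leq_trans dn) // addnBA ?(leq_trans dn) // addnC.
Qed.

Let sqfree_rec n b : q ^+ n = \sum_(j < n.+1./2.+1)
  1 ^+ j * \sum_(k <- monics F j) sqcount K 0 (n.+1 - j.*2) (b - nextc k *+ 2).
Proof.
rewrite -[n in LHS]add0n -(sum_sqcount 0 n b); apply: eq_bigr => j _.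
by rewrite expr1n mul1r.
Qed.

Let sqfree_deg0 b : sqcount K 0 0 b = (b == 0)%:R.
Proof. by rewrite sqcount_deg0 mul1r. Qed.

Lemma sqfree_count1 b : sqcount K 0 1 b = 1.
Proof.
have := sqfree_rec 0 b; rewrite big_ord1 !mul1r monics0 big_seq1 nextc1.
by rewrite mul0rn subr0.
Qed.

Lemma sqfree_count_odd n b : (2 : F) != 0 ->
  sqcount K 0 n.+2 b = q ^+ n.+1 - q ^+ n.
Proof.
by move=> F2; rewrite (square_recursion_odd sqfree_deg0 sqfree_rec) // mul1r.
Qed.

Lemma sqfree_count_even n b : (2 : F) = 0 -> sqcount K 0 n.+2 b =
  q ^+ n.+1 - q * (if n is m.+1 then q ^+ m else (b == 0)%:R).
Proof.
by move=> F2; rewrite (square_recursion_even sqfree_deg0 sqfree_rec) // mul1r.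
Qed.

(** The bound n on t is a convenient choice: every bound from [n./2] on gives the same ratio, by
    [densE]. *)
Let dens n b : K := sqcount K n n b / q ^+ n.

Let densE n N b : (n./2 <= N)%N -> sqcount K N n b = q ^+ N * dens n b.
Proof.
move=> nN; rewrite /dens mulrA; apply: (canRL (mulfK _)).
  by rewrite expf_neq0 // card_neq0.
rewrite mulrC /sqcount !mulr_sumr big_seq_cond [RHS]big_seq_cond.
apply: eq_bigr => f /andP[fn _].
rewrite -(sum_sqcoprime_shift 0 fn nN (half_leq n)).
by under [in RHS]eq_bigl do rewrite add0r.
Qed.

(** The decomposition is taken with N = n + 1. Passing from t to t / k divides the number of
    available polynomials by q^j, which is the source of x = 1 / q. *)
Let dens_rec n b : q ^+ n = \sum_(j < n.+1./2.+1)
  q^-1 ^+ j * \sum_(k <- monics F j) dens (n.+1 - j.*2) (b - nextc k *+ 2).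
Proof.
apply: (mulfI (expf_neq0 n.+1 (card_neq0 F K))).
rewrite -exprD -(sum_sqcount n.+1 n b) mulr_sumr; apply: eq_bigr => -[j /= jn] _.
have jn1 : (j <= n.+1)%N := leq_trans (jn : (j <= _)%N) (half_leq n.+1).
have qj : q ^+ n.+1 * q^-1 ^+ j = q ^+ (n.+1 - j).
  by rewrite -[in LHS](subnK jn1) exprD exprVn mulfK ?expf_neq0 ?card_neq0.
rewrite mulrA qj mulr_sumr; apply: eq_bigr => k _.
rewrite densE // (leq_trans (half_leq _)) // leq_sub2l // -addnn leq_addr //.
Qed.

Let dens_deg0 b : dens 0 b = (b == 0)%:R.
Proof. by rewrite /dens sqcount_deg0 mul1r divr1. Qed.

Let sum_sqcoprime_dens n (c : {poly F} -> {poly F}) b :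
  \sum_(f <- monics F n.+2 | nextc f == b)
    \sum_(t <- polys F n.+1 | sqcoprime f (c f + t)) (1 : K) = q ^+ n.+1 * dens n.+2 b.
Proof.
have n2 : (n.+2./2 <= n.+1)%N by rewrite -divn2 divn2 /= ltnS -divn2 leq_div.
have qn0 : q ^+ n.+1 != 0 by rewrite expf_neq0 // card_neq0.
rewrite -densE //; apply: (mulfI qn0).
rewrite /sqcount !mulr_sumr big_seq_cond [RHS]big_seq_cond.
by apply: eq_bigr => f /andP[fn _]; rewrite (sum_sqcoprime_shift _ fn n2 n2).
Qed.

Lemma sum_sqcoprime_odd n (c : {poly F} -> {poly F}) b : (2 : F) != 0 ->
  \sum_(f <- monics F n.+2 | nextc f == b)
    \sum_(t <- polys F n.+1 | sqcoprime f (c f + t)) 1 =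
  q ^+ n.+1 * (q ^+ n.+1 - q^-1 * q ^+ n).
Proof.
move=> F2.
by rewrite sum_sqcoprime_dens (square_recursion_odd dens_deg0 dens_rec).
Qed.

Lemma sum_sqcoprime_even n (c : {poly F} -> {poly F}) b : (2 : F) = 0 ->
  \sum_(f <- monics F n.+2 | nextc f == b)
    \sum_(t <- polys F n.+1 | sqcoprime f (c f + t)) 1 =
  q ^+ n.+1 * (q ^+ n.+1 - (if n is m.+1 then q ^+ m else (b == 0)%:R)).
Proof.
move=> F2; rewrite sum_sqcoprime_dens (square_recursion_even dens_deg0 dens_rec) //.
by rewrite mulVf ?card_neq0 // mul1r.
Qed.

Lemma sqcoprime_mulXsubC s r :
  sqcoprime (('X - r%:P) * s) 0 = sqcoprime s 0 && ~~ root s r.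
Proof.
have Xr0 : 'X - r%:P != 0 by rewrite polyXsubC_eq0.
apply/sqcoprimeP/andP => [h|[/sqcoprimeP h rs] d].
  split; first by apply/sqcoprimeP => d ds d0; apply: h; rewrite ?dvdp_mull.
  apply/negP; rewrite -dvdp_XsubCl => rs.
  have := h ('X - r%:P); rewrite expr2 dvdp_mul2l // rs dvdp0 size_XsubC.
  by move=> /(_ isT isT).
move=> drs d0; have [dr|dr] := boolP (root d r); last first.
  by apply: h => //; move: drs; rewrite Gauss_dvdpr // coprimep_expl ?coprimep_XsubC.
case/negP: rs; rewrite -dvdp_XsubCl -(dvdp_mul2l _ _ Xr0).
apply: dvdp_trans drs; rewrite -dvdp_XsubCl in dr.
by rewrite expr2 dvdp_mul.
Qed.

Definition sqfree_nroot_count r n b : K :=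
  \sum_(f <- monics F n | [&& nextc f == b, sqcoprime f 0 & ~~ root f r]) 1.

Lemma sqcount0E n b :
  sqcount K 0 n b = \sum_(f <- monics F n | (nextc f == b) && sqcoprime f 0) 1.
Proof.
have p0 : polys F 0 = [:: 0].
  have := size_polys F 0; rewrite expn0; case E: (polys F 0) => [|t [|]] // _.
  have : 0 \in polys F 0 by rewrite mem_polys size_poly0.
  by rewrite E inE => /eqP <-.
rewrite [RHS]big_mkcondr; apply: eq_bigr => f _; by rewrite p0 big_mkcond big_seq1.
Qed.

(** A squarefree multiple of X - r is (X - r) s with s squarefree and s(r) <> 0, and [nextc] of the
    product is [nextc s - r]. *)
Lemma sqfree_nroot_count_rec r n b :
  sqcount K 0 n.+1 b = sqfree_nroot_count r n.+1 b + sqfree_nroot_count r n (b + r).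
Proof.
have rm : 'X - r%:P \in monics F 1 by rewrite mem_monics monicXsubC size_XsubC.
rewrite sqcount0E (bigID (fun f => root f r)) /= addrC; congr (_ + _).
  by apply: eq_bigl => f; rewrite andbA.
rewrite (eq_bigl (fun f => ('X - r%:P %| f) &&
    ((nextc f == b) && sqcoprime f 0))) => [|f]; last by rewrite dvdp_XsubCl andbC.
rewrite big_mkcondr (sum_monics_dvd _ rm) // subSS subn0 [RHS]big_mkcond.
apply: eq_big_seq => s /monicsP[sm _]; rewrite nextcM ?monicXsubC // nextcXsubC.
by rewrite sqcoprime_mulXsubC addrC subr_eq.
Qed.

Lemma sqfree_nroot_count0 r b : sqfree_nroot_count r 0 b = (b == 0)%:R.
Proof.
rewrite -[RHS]sqfree_deg0 sqcount0E /sqfree_nroot_count monics0.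
by rewrite big_mkcond [RHS]big_mkcond !big_seq1 root1 andbT.
Qed.

(** Unrolling the recursion alternates signs and moves b to b + (n + 1) r in degree 0, where the
    polynomial 1 contributes an indicator. The -1 centres this indicator: the last term has sum zero
    over b, so the first one is the mean. *)
Lemma sqfree_nroot_countE r n b : (2 : F) != 0 ->
  q * sqfree_nroot_count r n.+1 b = (q - 1) / (q + 1) * (q ^+ n.+1 - (-1) ^+ n.+1) +
    (-1) ^+ n.+1 * (q * (b + r *+ n.+1 == 0)%:R - 1).
Proof.
move=> F2; have q1 : q + 1 != 0 by rewrite natr1 pnatr_eq0.
elim: n b => [|n IHn] b.
  have := sqfree_nroot_count_rec r 0 b; rewrite sqfree_count1 sqfree_nroot_count0.
  move/esym/(canRL (addrK _)) => ->; rewrite mulr1n.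
  by field.
have := sqfree_nroot_count_rec r n.+1 b; rewrite sqfree_count_odd //.
move/esym/(canRL (addrK _)) => ->; rewrite mulrBr IHn.
by rewrite -addrA -mulrS !exprS; field.
Qed.

(** For n invertible the only zero is - b / n; otherwise no r or every r is one. Over F_p the value
    is iota + 1. *)
Lemma sum_affine_zeros b n : \sum_r (b + r *+ n == 0)%:R =
  if (n%:R : F) != 0 then 1 else if b != 0 then 0 else q.
Proof.
case: ifPn => [n0|].
  rewrite (bigD1 (- b / n%:R)) //= -[X in b + X]mulr_natr mulfVK // subrr eqxx.
  rewrite big1 ?addr0 // => r rb; rewrite -[X in b + X]mulr_natr.
  rewrite addrC addr_eq0; case: eqP => // E; case/eqP: rb.
  by rewrite -E mulfK.
rewrite negbK => /eqP n0.
under eq_bigr do rewrite -[X in b + X]mulr_natr n0 mulr0 addr0.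
by rewrite sumr_const; case: eqP => _ //=; rewrite mul0rn.
Qed.

(** The cofactor of (X - r)^2 has coefficient b + 2 r, so the indicator concerns b + (n + 2) r; this
    is how the full degree n + 2 enters iota. Degree 0 does not follow the general formula and leads
    to the separate value for quadratic polynomials. *)
Lemma sum_sqfree_nroot_count n b : (2 : F) != 0 ->
  \sum_r sqfree_nroot_count r n (b + r *+ 2) =
  if n == 0%N then 1 else (q - 1) / (q + 1) * (q ^+ n - (-1) ^+ n) +
    (-1) ^+ n * (if (n.+2%:R : F) != 0 then 0 else if b != 0 then -1 else q - 1).
Proof.
move=> F2; case: n => [|n] /=.
  under eq_bigr do rewrite sqfree_nroot_count0.
  by rewrite sum_affine_zeros F2.
apply: (mulfI (card_neq0 F K)).
rewrite mulr_sumr; under eq_bigr do rewrite sqfree_nroot_countE // -addrA -mulrnDr.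
rewrite big_split /= sumr_const [RHS]mulrDr; congr (_ + _); first by rewrite -[LHS]mulr_natl.
rewrite -mulr_sumr mulrCA; congr (_ * _).
rewrite sumrB -mulr_sumr sumr_const sum_affine_zeros.
by do 2?case: ifP => _; ring.
Qed.

End SquareCounts.

(** * Pairs whose first member has exactly one double root *)

Section DoubleRoot.
Variables (F : finFieldType) (K : numFieldType).
Implicit Types (f t : {poly F}) (b r : F).
Local Notation q := (#|F|%:R : K).

(** Phrased through [sqkernel], so that X - r is at once the period of the condition on t. *)
Definition double_root_at f r : bool :=
  sqkernel f 0 ('X - r%:P) && ~~ root (f %/ ('X - r%:P) ^+ 2) r.

Definition double_root f : bool := [exists r, double_root_at f r].

Lemma double_rootP f : reflect (exists r, double_root_at f r) (double_root f).
Proof. exact: existsP. Qed.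

Lemma XsubC_monics r : 'X - r%:P \in monics F 1.
Proof. by rewrite mem_monics monicXsubC size_XsubC. Qed.

Lemma double_root_at_uniq f r (s : F) : f != 0 ->
  double_root_at f r -> double_root_at f s -> r = s.
Proof.
move=> f0 /andP[fr _] /andP[fs _]; apply/eqP.
have /polyP/(_ 0%N) := sqkernel_uniq f0 (monicXsubC r) (monicXsubC s) fr fs.
by rewrite !coefB !coefX !coefC !sub0r => /oppr_inj ->.
Qed.

Lemma sum_double_root_at f : f != 0 ->
  \sum_r (if double_root_at f r then 1 else 0) = (if double_root f then 1 else 0) :> K.
Proof.
move=> f0; case: (double_rootP f) => [[r fr]|fN].
  rewrite (bigD1 r) //= fr big1 ?addr0 // => s; case: ifP => // fs.
  by rewrite (double_root_at_uniq f0 fs fr) eqxx.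
by apply: big1 => r _; case: ifP => // fr; case: fN; exists r.
Qed.

(** The period is X - r, so only the value of c + t at r matters. It has to be nonzero, and each of
    the q - 1 nonzero values is taken q^n times. *)
Lemma double_root_weight f c n : f \in monics F n.+2 -> double_root f ->
  \sum_(t <- polys F n.+1 | sqcoprime f (c + t)) 1 = q ^+ n * (q - 1) :> K.
Proof.
move=> /monicsP[fm fs] /double_rootP[r /andP[fr _]]; have f0 := monic_neq0 fm.
pose E t : K := if sqcoprime f t then 1 else 0.
have E_mod a t : E (a * ('X - r%:P) + t) = E t by rewrite /E sqkernel_periodic.
rewrite big_mkcond (sum_polys_periodic (E := E) c (XsubC_monics r) E_mod) //.
rewrite subSS subn0 -[LHS]mulr_natl natrX; congr (_ * _).
have p1 : 0 \in polys F 1 by rewrite mem_polys size_poly0.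
rewrite (big_rem 0) //= {1}/E; case: ifP => [/sqcoprimeP/(_ ('X - r%:P))|_].
  by case/and3P: fr => -> _ _; rewrite dvdp0 size_XsubC => /(_ isT isT).
rewrite add0r rem_filter ?polys_uniq // big_filter.
transitivity (\sum_(t <- polys F 1 | t != 0) (1 : K)).
  rewrite big_seq_cond [RHS]big_seq_cond; apply: eq_bigr => t /andP[+ t0].
  rewrite mem_polys /E => t1; case: sqcoprimeP => // -[] d _ dt.
  exact: leq_trans (dvdp_leq t0 dt) t1.
apply: (canRL (addrK _)); rewrite -[q]expr1 -(sum_polys1 F K) [RHS](big_rem 0) //=.
by rewrite addrC rem_filter ?polys_uniq // big_filter.
Qed.

Lemma sum_double_root n (c : {poly F} -> {poly F}) b :
  \sum_(f <- monics F n.+2 | (nextc f == b) && double_root f)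
    \sum_(t <- polys F n.+1 | sqcoprime f (c f + t)) 1 =
  q ^+ n * (q - 1) * \sum_r sqfree_nroot_count K r n (b + r *+ 2).
Proof.
transitivity (\sum_(f <- monics F n.+2 | nextc f == b)
    \sum_r (if double_root_at f r then q ^+ n * (q - 1) else 0)).
  rewrite big_mkcondr big_seq_cond [RHS]big_seq_cond; apply: eq_bigr => f /andP[fn _].
  have f0 : f != 0 by case/monicsP: fn => /monic_neq0.
  have -> : \sum_r (if double_root_at f r then q ^+ n * (q - 1) else 0) =
      q ^+ n * (q - 1) * \sum_r (if double_root_at f r then 1 else 0).
    by rewrite mulr_sumr; apply: eq_bigr => r _; case: ifP; rewrite ?mulr1 ?mulr0.
  rewrite sum_double_root_at //; case: ifP => fr; last by rewrite mulr0.
  by rewrite mulr1 double_root_weight.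
rewrite exchange_big mulr_sumr; apply: eq_bigr => r _ /=.
have rm : ('X - r%:P) ^+ 2 \in monics F 2.
  by rewrite mem_monics monic_exp ?monicXsubC // size_sqr ?polyXsubC_eq0 // size_XsubC.
have r0 : ('X - r%:P) ^+ 2 != 0 by rewrite expf_neq0 // polyXsubC_eq0.
transitivity (\sum_(f <- monics F n.+2 | ('X - r%:P) ^+ 2 %| f)
    if [&& nextc f == b, sqcoprime (f %/ ('X - r%:P) ^+ 2) 0
         & ~~ root (f %/ ('X - r%:P) ^+ 2) r] then q ^+ n * (q - 1) else 0).
  rewrite big_mkcond [RHS]big_mkcond; apply: eq_bigr => f _.
  rewrite /double_root_at /sqkernel dvdp0 div0p /=.
  by case: eqP => _ /=; case: (_ %| f); rewrite //= if_same.
rewrite (sum_monics_dvd _ rm) // subSS subSS subn0.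
rewrite /sqfree_nroot_count mulr_sumr [RHS]big_mkcond.
apply: eq_big_seq => s /monicsP[sm _].
rewrite nextcM ?monic_exp ?monicXsubC // expr2 nextcM ?monicXsubC // nextcXsubC.
rewrite -expr2 mulKp // mulr1 -opprD -mulr2n addrC subr_eq.
done.
Qed.

End DoubleRoot.

(** * Dedekind's criterion *)

Lemma irreducible_factor (F : fieldType) (h : {poly F}) : (1 < size h)%N ->
  exists2 d, irreducible_poly d & d %| h.
Proof.
move=> h1; pose P m := `[< exists d, [/\ d %| h, (1 < size d)%N & size d = m] >].
have exP : exists m, P m by exists (size h); apply/asboolP; exists h.
have [m /asboolP[d [dh d1 dm]] minm] := ex_minnP exP.
exists d => //; split=> // a a1 ad; have d0 : d != 0 by rewrite -size_poly_gt0 ltnW.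
have a0 : a != 0 by apply: contraNneq d0 => a0; move: ad; rewrite a0 dvd0p.
rewrite -dvdp_size_eqp // eqn_leq dvdp_leq // dm minm //.
apply/asboolP; exists a; split=> //; first exact: dvdp_trans dh.
by rewrite ltn_neqAle eq_sym a1 size_poly_gt0.
Qed.

Lemma irreducible_dvd_exp (F : fieldType) (d h : {poly F}) n :
  irreducible_poly d -> d %| h ^+ n -> d %| h.
Proof.
move=> dirr; elim: n => [|n IHn].
  rewrite expr0 => /(dvdp_leq (oner_neq0 _)); rewrite size_poly1.
  by case: dirr => d1 _; rewrite leqNgt d1.
rewrite exprS; case: (boolP (d %| h)) => // dh.
rewrite Gauss_dvdpr; last by rewrite irreducible_poly_coprime.
by move/IHn => dh'; rewrite dh' in dh.
Qed.

Section Reduction.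
Variables (A : idomainType) (F : fieldType) (red : {rmorphism A -> F}) (pi : A).
Hypothesis red_surj : forall c, exists a, red a = c.
Hypothesis red_ker : forall a, red a = 0 -> exists b, a = pi * b.
Hypothesis red_pi : red pi = 0.
Local Notation rp := (map_poly red).

Lemma red_poly_surj h : exists g, rp g = h.
Proof.
have [s sE] := choice red_surj; exists (\poly_(i < size h) s h`_i).
apply/polyP => i; rewrite coef_map coef_poly; case: ltnP => hi; first exact: sE.
by rewrite raddf0 nth_default.
Qed.

Lemma red_polyC : rp pi%:P = 0. Proof. by rewrite map_polyC /= red_pi polyC0. Qed.

Lemma red_poly_ker g : rp g = 0 -> exists h, g = pi%:P * h.
Proof.
move=> g0; have gi i : exists b, g`_i = pi * b.
  by apply: red_ker; rewrite -coef_map g0 coef0.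
have [s sE] := choice gi; exists (\poly_(i < size g) s i).
apply/polyP => i; rewrite coefCM coef_poly; case: ltnP => hi; first exact: sE.
by rewrite mulr0 nth_default.
Qed.

Lemma red_poly_eq g h : rp g = rp h -> exists a, g = h + pi%:P * a.
Proof.
move=> gh; have [a gha] : exists a, g - h = pi%:P * a.
  by apply: red_poly_ker; rewrite rmorphB /= gh subrr.
by exists a; rewrite -gha subrKC.
Qed.

Lemma red_poly_dvd d g : rp d %| rp g -> exists a b, g = d * a + pi%:P * b.
Proof.
move=> dg; have [a aE] := red_poly_surj (rp g %/ rp d).
have [b gE] : exists b, g = d * a + pi%:P * b.
  by apply: red_poly_eq; rewrite rmorphM /= aE mulrC divpK.
by exists a, b.
Qed.

(* That is, [f] lies in the square of the ideal [(pi, d)]. *)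
Definition dedekind_bad (f : {poly A}) : Prop :=
  exists d u v w, f = d ^+ 2 * u + pi%:P * d * v + pi%:P ^+ 2 * w /\
    (1 < size (rp d))%N.

Variables (B : comNzRingType) (qmap : {rmorphism {poly A} -> B}) (f : {poly A}) (wi : B).
Hypothesis f_monic : f \is monic.
Hypothesis qmap_ker : forall g, qmap g = 0 -> exists h, g = f * h.
Hypothesis qmap_f : qmap f = 0.
Local Notation w := (qmap pi%:P).
Hypothesis wiK : wi * w = 1.
Implicit Types (T : set B) (g : {poly A}).

Let rf0 : rp f != 0. Proof. by rewrite monic_neq0 // monic_map. Qed.

Let wI : injective ( *%R w).
Proof. by move=> x y /(congr1 ( *%R wi)); rewrite !mulrA wiK !mul1r. Qed.

Definition overring T : Prop :=
  [/\ forall g, T (qmap g), forall x y, T x -> T y -> T (x - y) &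
      forall x y, T x -> T y -> T (x * y)].

(** Take y = (d u + pi v) / pi. From d (d u + pi v) = f - pi^2 c follow d y = - pi c and y^2 = v y -
    u c, so A[x] + A[x] y is a ring. If y came from A[x], then f would divide d u modulo pi, which
    is impossible as f = d^2 u there. *)
Lemma dedekind_bad_overring : dedekind_bad f -> exists y : B,
  overring [set z | exists a b, z = qmap a + qmap b * y] /\ forall g, qmap g <> y.
Proof.
case=> d [u [v [c [fE d1]]]]; pose g := d * u + pi%:P * v.
pose y := wi * qmap g.
have wy : w * y = qmap g by rewrite /y mulrA (mulrC w) wiK mul1r.
have dy : qmap d * y = - w * qmap c.
  apply: wI; rewrite mulrCA wy -rmorphM.
  have -> : d * g = f - pi%:P ^+ 2 * c by rewrite fE /g; ring.
  by rewrite rmorphB qmap_f !rmorphM /=; ring.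
have yy : y * y = qmap v * y - qmap (u * c).
  apply: wI; rewrite mulrA wy {1}/g rmorphD mulrDl 2!rmorphM mulrAC dy !rmorphM /=.
  by ring.
exists y; split; last first.
  move=> a ay; move: wy; rewrite -ay -rmorphM => /eqP; rewrite -subr_eq0 -rmorphB.
  move=> /eqP /qmap_ker[h aE].
  have fdu : rp f = rp d ^+ 2 * rp u.
    rewrite fE !rmorphD !rmorphM /= red_polyC.
    by rewrite !mul0r !addr0 expr2.
  have E : rp d * rp u = - rp f * rp h.
    have := congr1 (map_poly red) aE.
    rewrite rmorphB /g rmorphD !rmorphM /= red_polyC !mul0r addr0 sub0r => E.
    by rewrite mulNr -E opprK.
  have := rf0; rewrite fdu mulf_eq0 negb_or expf_eq0 /= => /andP[d0 u0].
  have du0 : rp d * rp u != 0 by rewrite mulf_neq0.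
  have : rp d %| 1.
    rewrite -(dvdp_mul2r _ _ du0) mul1r; apply/dvdpP; exists (- rp h).
    by rewrite {1}E fdu; ring.
  by move/(dvdp_leq (oner_neq0 _)); rewrite size_poly1 leqNgt d1.
split.
- by move=> a; exists a, 0; rewrite rmorph0 mul0r addr0.
- move=> _ _ [a [b ->]] [a' [b' ->]]; exists (a - a'), (b - b').
  by rewrite !rmorphB /=; ring.
- move=> _ _ [a [b ->]] [a' [b' ->]].
  exists (a * a' - b * b' * (u * c)), (a * b' + a' * b + b * b' * v).
  rewrite mulrDl !mulrDr mulrACA yy !(rmorphB, rmorphD, rmorphM) /=; ring.
Qed.

(* As T is bounded, g / pi in T forces g to be nilpotent mod pi; this replaces
   integrality. *)
Lemma overring_dedekind_bad T N : overring T ->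
  (forall z, T z -> exists g, w ^+ N * z = qmap g) ->
  (exists2 z, T z & forall g, qmap g <> z) -> dedekind_bad f.
Proof.
move=> [TO TB TM] TN [z0 Tz0 z0O].
have T0 : T 0 by rewrite -(rmorph0 qmap); exact: TO.
have Topp x : T x -> T (- x) by move=> Tx; rewrite -sub0r; apply: TB.
have TD x y : T x -> T y -> T (x + y).
  by move=> Tx Ty; rewrite -[y]opprK; apply: TB => //; apply: Topp.
have TX x m : T x -> T (x ^+ m).
  move=> Tx; elim: m => [|m IHm]; first by rewrite expr0; have := TO 1; rewrite rmorph1.
  by rewrite exprS; exact: TM.
(* J is the ideal of the g with g / pi in T; it contains f. *)
pose J g := exists2 t, T t & w * t = qmap g.
have JD g h : J g -> J h -> J (g + h).
  move=> [s Ts sg] [t Tt th]; exists (s + t); first exact: TD.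
  by rewrite mulrDr sg th rmorphD.
have JM a g : J g -> J (a * g).
  move=> [t Tt tg]; exists (qmap a * t); first exact: TM.
  by rewrite mulrCA tg rmorphM.
have Jf : J f by exists 0; rewrite ?mulr0 ?qmap_f.
(* For z0 in T outside A[x], let g represent pi^m z0 with m least. If f divided g modulo pi, a
   factor pi could be cancelled, contradicting the choice of m. *)
have [g [Jg gf]] : exists g, J g /\ ~~ (rp f %| rp g).
  pose P m := `[< exists g, w ^+ m * z0 = qmap g >].
  have [m /asboolP[g zg] minm] := ex_minnP (ex_intro P N (asboolT (TN _ Tz0))).
  case: m => [|m] in zg minm *; first by case: (z0O g); rewrite -zg mul1r.
  exists g; split.
    exists (w ^+ m * z0); last by rewrite mulrA -exprS.
    by apply: TM => //; apply: TX.
  apply/negP => /red_poly_dvd[a [b gE]]; suff: P m by move/minm; rewrite ltnn.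
  apply/asboolP; exists b; apply: wI; rewrite mulrA -exprS zg gE.
  by rewrite rmorphD !rmorphM qmap_f /= mul0r add0r.
(* For t = h / pi, h^(N+1) = pi (pi^N t^(N+1)) is a multiple of pi modulo f, so d divides a power of
   h modulo pi. *)
have Jirr d h : irreducible_poly d -> d %| rp f -> J h -> d %| rp h.
  move=> dirr df [t Tt th]; apply: (irreducible_dvd_exp (n := N.+1)) => //.
  have [b tb] := TN _ (TX _ N.+1 Tt).
  have : qmap (h ^+ N.+1 - pi%:P * b) = 0.
    rewrite rmorphB rmorphXn -th rmorphM -tb /= exprMn exprS; ring.
  case/qmap_ker => a /(congr1 (map_poly red)).
  rewrite rmorphB rmorphXn !rmorphM /= red_polyC mul0r subr0 => ->.
  exact: dvdp_mulr.
(* A lift j of gcd(f, g) is found inside J, and f = j k + pi r with k nonconstant modulo pi. A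
   nonconstant d dividing j, k and r modulo pi then puts f into the square of (pi, d). *)
have [[x y] /= xy] := Bezoutp (rp f) (rp g).
have [x' xE] := red_poly_surj x; have [y' yE] := red_poly_surj y.
pose j := x' * f + y' * g.
have Jj : J j by apply: JD; apply: JM.
have jg : rp j %= gcdp (rp f) (rp g).
  by rewrite rmorphD !rmorphM /= xE yE.
have jf : rp j %| rp f by rewrite (eqp_dvdl _ jg) dvdp_gcdl.
have j0 : rp j != 0 by apply: contraNneq rf0 => j0; move: jf; rewrite j0 dvd0p.
have k1 : (1 < size (rp f %/ rp j)%R)%N.
  rewrite ltnNge; apply: contra gf => k1.
  have : rp f %| rp j.
    rewrite -{1}(divpK jf) -[X in _ %| X]mul1r dvdp_mul2r //.
    rewrite dvdp1 eqn_leq k1 size_poly_gt0.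
    by apply: contraNneq rf0 => k0; rewrite -(divpK jf) k0 mul0r.
  by move/dvdp_trans; apply; rewrite (eqp_dvdl _ jg) dvdp_gcdr.
have [d dirr dk] := irreducible_factor k1.
have d0 : d != 0 by case: dirr => d1 _; rewrite -size_poly_gt0 ltnW.
have [k kE] := red_poly_surj (rp f %/ rp j).
have dkf : rp k %| rp f by rewrite kE; apply: divp_dvd.
have [r fE] : exists r, f = j * k + pi%:P * r.
  by apply: red_poly_eq; rewrite rmorphM /= kE mulrC divpK.
have df : d %| rp f by apply: dvdp_trans dkf; rewrite kE.
have dj : d %| rp j by apply: Jirr Jj.
(* With t = j / pi in T, k t = - r. Let [tt] be the part of f coprime to d; as d | k, f divides k^e
   [tt] modulo pi. Hence r^e [tt] = (- t)^e k^e [tt] lies in pi T, so d divides r^e [tt] and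
   therefore r. *)
have dr : d %| rp r.
  have [tt ttE] := red_poly_surj (gdcop d (rp f)).
  pose e := size (rp f).
  have [a [b kt]] : exists a b, k ^+ e * tt = f * a + pi%:P * b.
    apply: red_poly_dvd; rewrite rmorphM rmorphXn /= kE ttE mulrC.
    apply: dvdp_trans (dvdp_gdcor (rp f) d0) _.
    by rewrite dvdp_mul // dvdp_exp2r.
  have [t Tt tj] := Jj.
  have kt' : qmap k * t = - qmap r.
    apply: wI; rewrite mulrCA tj mulrN -!rmorphM -rmorphN.
    have -> : - (pi%:P * r) = k * j - f by rewrite [X in _ - X]fE; ring.
    by rewrite [in RHS]rmorphB qmap_f subr0.
  have : d %| rp (r ^+ e * tt).
    apply: Jirr => //; exists ((- t) ^+ e * qmap b).
      by apply: TM => //; apply: TX; apply: Topp.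
    rewrite rmorphM rmorphXn -[qmap r]opprK -kt' -mulrN exprMn mulrAC.
    rewrite -rmorphXn -rmorphM kt rmorphD !rmorphM qmap_f /=; ring.
  rewrite rmorphM /= ttE mulrC Gauss_dvdpr.
    by rewrite rmorphXn; apply: irreducible_dvd_exp.
  by rewrite coprimep_sym coprimep_gdco.
have [D DE] := red_poly_surj d; rewrite -{}DE in dirr d0 dk dr df dj.
have [a [a' jE]] := red_poly_dvd dj.
have [b [b' kE']] : exists b b', k = D * b + pi%:P * b'.
  by apply: red_poly_dvd; rewrite kE.
have [c [c' rE]] := red_poly_dvd dr.
exists D, (a * b), (a * b' + a' * b + c), (a' * b' + c'); split.
  by rewrite fE jE kE' rE; ring.
by case: dirr.
Qed.

End Reduction.

Section ReductionShift.
Variables (A : idomainType) (F : fieldType) (red : {rmorphism A -> F}) (pi : A).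
Hypothesis red_surj : forall c, exists a, red a = c.
Hypothesis red_ker : forall a, red a = 0 -> exists b, a = pi * b.
Hypothesis red_pi : red pi = 0.
Hypothesis pi_neq0 : pi != 0.
Local Notation rp := (map_poly red).
Implicit Types f g m s t : {poly A}.

(** Any d with d^2 | f modulo pi divides m there, so m = d a + pi b and m^2 s lies in the square of
    (pi, d). Thus f lies in it exactly when pi t does, that is, when d | t modulo pi. *)
Lemma dedekind_badP f m s t :
    f \is monic -> f = m ^+ 2 * s + pi%:P * t -> sqkernel (rp f) 0 (rp m) ->
  dedekind_bad red pi f <-> ~~ sqcoprime (rp f) (rp t).
Proof.
move=> fm fE km; have f0 : rp f != 0 by rewrite monic_neq0 ?monic_map.
have P0 := red_polyC red_pi.
have PI : pi%:P != 0 by rewrite polyC_eq0.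
split=> [[d [u [v [w [fE' d1]]]]]|/sqcoprimeP/existsNP[d' ]].
  have df : rp d ^+ 2 %| rp f.
    rewrite fE' !rmorphD !rmorphM /= P0 !mul0r !addr0 expr2.
    exact: dvdp_mulIl.
  have dm : rp d %| rp m by apply: sqkernel_max km _ _; rewrite ?dvdp0.
  have [a [b mE]] := red_poly_dvd red_surj red_ker dm.
  have tE : pi%:P * t = d ^+ 2 * (u - a ^+ 2 * s) +
      pi%:P * (d * (v - a * b * s *+ 2) + pi%:P * (w - b ^+ 2 * s)).
    have -> : pi%:P * t = f - m ^+ 2 * s by rewrite fE; ring.
    by rewrite fE' mE; ring.
  (* Modulo pi the product d^2 (u - a^2 s) vanishes and d does not; so pi can be cancelled from the
     whole identity for pi t. *)
  have [e eE] : exists e, u - a ^+ 2 * s = pi%:P * e.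
    apply: (red_poly_ker red_ker).
    have d0 : rp d ^+ 2 != 0 by rewrite expf_neq0 // -size_poly_gt0 ltnW.
    apply: (mulfI d0); rewrite mulr0 -rmorphXn -rmorphM /=.
    have := congr1 rp tE; rewrite rmorphD !(rmorphM _ pi%:P) /= P0 !mul0r addr0.
    by move=> <-.
  have {}tE : t = d * (d * e + (v - a * b * s *+ 2)) + pi%:P * (w - b ^+ 2 * s).
    by apply: (mulfI PI); rewrite tE eE; ring.
  apply/sqcoprimeP => /(_ (rp d) df); rewrite leqNgt d1 => H.
  suff /H : rp d %| rp t by [].
  by rewrite tE rmorphD !(rmorphM) /= P0 mul0r addr0 dvdp_mulIl.
move=> /not_implyP[d'f /not_implyP[d't /negP]]; rewrite -ltnNge => d1.
have dm : d' %| rp m by apply: sqkernel_max km _ _; rewrite ?dvdp0.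
have [d dE] := red_poly_surj red_surj d'; rewrite -{}dE in d'f d't d1 dm.
have [a [b mE]] := red_poly_dvd red_surj red_ker dm.
have [c [e tE]] := red_poly_dvd red_surj red_ker d't.
exists d, (a ^+ 2 * s), (a * b * s *+ 2 + c), (b ^+ 2 * s + e); split=> //.
by rewrite fE mE tE; ring.
Qed.

Lemma sqkernel_lift f : f \is monic -> exists m s t,
  f = m ^+ 2 * s + pi%:P * t /\ sqkernel (rp f) 0 (rp m).
Proof.
move=> fm; have [k km kf] := sqkernel_exists 0 (monic_map red fm).
have [m mE] := red_poly_surj red_surj k; rewrite -{}mE in kf.
have m2f : rp (m ^+ 2) %| rp f by rewrite rmorphXn /=; case/and3P: kf.
have [s [t fE]] := red_poly_dvd red_surj red_ker m2f.
by exists m, s, t.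
Qed.

(** The decomposition f = m^2 s + pi t is fixed once; adding pi g only turns t into t + g, so one t
    serves all g. *)
Lemma dedekind_bad_shift f : f \is monic -> exists t, forall g,
  f + pi%:P * g \is monic ->
  dedekind_bad red pi (f + pi%:P * g) <-> ~~ sqcoprime (rp f) (rp t + rp g).
Proof.
move=> fm; have [m [s [t [fE km]]]] := sqkernel_lift fm; exists t => g fgm.
have fg : rp (f + pi%:P * g) = rp f.
  by rewrite rmorphD rmorphM /= (red_polyC red_pi) mul0r addr0.
have := @dedekind_badP (f + pi%:P * g) m s (t + g) fgm.
rewrite fg rmorphD; apply=> //.
by rewrite [in LHS]fE mulrDr addrA.
Qed.

End ReductionShift.

(** * Orders of K[x]/(f) and denominators that are powers of pi *)

Section FractionDenominators.
Variables (A : idomainType) (pi : A).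
Hypothesis pi_denom : forall a : A, a != 0 -> exists N b, pi ^+ N = a * b.

Lemma fraction_denom (x : {fraction A}) : exists2 d, d != 0 &
  exists n, tofrac d * x = tofrac n.
Proof.
elim/quotW: x => r; exists (frac r).2; first exact: denom_ratioP.
exists (frac r).1.
(* The quotient construction is unfolded: the product becomes one of ratios, and equality becomes
   cross-multiplication. *)
rewrite -[LHS]/(FracField.mul (tofrac (frac r).2) _) !piE.
apply/eqmodP; rewrite /= FracField.equivfE /FracField.mulf.
by rewrite !numden_Ratio ?(oner_eq0, mulf_neq0, denom_ratioP) // mulr1 mul1r.
Qed.

Lemma fraction_pi_denom (x : {fraction A}) : exists N n,
  tofrac (pi ^+ N) * x = tofrac n.
Proof.
have [d d0 [n xE]] := fraction_denom x; have [N [b bE]] := pi_denom d0.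
by exists N, (b * n); rewrite bE !tofracM -xE; ring.
Qed.

Lemma poly_pi_denom (h : {poly {fraction A}}) : exists N g,
  (tofrac (pi ^+ N))%:P * h = frac_poly g.
Proof.
elim/poly_ind: h => [|h c [N [g hE]]].
  by exists 0, 0; rewrite mulr0 /frac_poly raddf0.
have [M [n cE]] := fraction_pi_denom c.
exists (M + N)%N, ((pi ^+ M)%:P * g * 'X + (pi ^+ N * n)%:P).
rewrite /frac_poly rmorphD !rmorphM /= map_polyX !map_polyC /= -/(frac_poly g) -hE.
by rewrite -cE exprD tofracM !polyCM; ring.
Qed.

Variable f : {poly A}.
Hypotheses (f_monic : f \is monic) (f_gt1 : (1 < size f)%N).
Hypothesis pi_neq0 : pi != 0.
Local Notation K := {fraction A}.
Local Notation B := {poly %/ frac_poly f}.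
Implicit Types (g : {poly A}) (z : B) (s : seq B).

Definition qfrac : {rmorphism {poly A} -> B} :=
  in_qpoly (frac_poly f) \o map_poly (@tofrac A).

Definition qinv : B := in_qpoly (frac_poly f) (tofrac pi)^-1%:P.

Lemma tofrac_inj : injective (@tofrac A).
Proof. by move=> x y /eqP; rewrite tofrac_eq => /eqP. Qed.

Lemma size_frac_poly g : size (frac_poly g) = size g.
Proof. by rewrite size_map_inj_poly ?tofrac0 //; exact: tofrac_inj. Qed.

Lemma frac_poly_monic : frac_poly f \is monic.
Proof. exact: monic_map. Qed.

Lemma mk_monic_frac : mk_monic (frac_poly f) = frac_poly f.
Proof. by rewrite /mk_monic size_frac_poly f_gt1 frac_poly_monic. Qed.

Lemma qfrac_self : qfrac f = 0.
Proof. by apply: val_inj; rewrite /= mk_monic_frac Pdiv.RingMonic.rmodpp ?frac_poly_monic. Qed.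

Lemma qinvK : qinv * qfrac pi%:P = 1.
Proof.
rewrite /qinv /= map_polyC /= -in_qpolyM -polyCM mulVf ?in_qpoly1 //.
by rewrite tofrac_eq0.
Qed.

Lemma qfrac_small g : (size g < size f)%N -> qfrac g = frac_poly g :> {poly K}.
Proof. by move=> gf; rewrite in_qpoly_small // mk_monic_frac !size_frac_poly. Qed.

Lemma qfrac_mod g : exists2 r : {poly A}, (size r < size f)%N & exists h, g = f * h + r.
Proof.
exists (Pdiv.Ring.rmodp g f); first by rewrite Pdiv.Ring.ltn_rmodp monic_neq0.
by exists (Pdiv.Ring.rdivp g f); rewrite mulrC -Pdiv.RingMonic.rdivp_eq.
Qed.

Lemma qfrac_ker g : qfrac g = 0 -> exists h, g = f * h.
Proof.
have [r rf [h ->]] := qfrac_mod g.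
rewrite rmorphD rmorphM qfrac_self mul0r add0r => r0; exists h.
have : size (frac_poly r) = 0%N by rewrite -qfrac_small // r0 size_poly0.
by rewrite size_frac_poly => /eqP; rewrite size_poly_eq0 => /eqP ->; rewrite addr0.
Qed.

Lemma qfrac_denom z : exists N g, qfrac pi%:P ^+ N * z = qfrac g.
Proof.
have [N [g zE]] := poly_pi_denom (z : {poly K}); exists N, g.
have -> : z = in_qpoly (frac_poly f) z.
  by apply: val_inj; rewrite /= Pdiv.CommonRing.rmodp_small // size_mk_monic.
have -> : qfrac g = in_qpoly (frac_poly f) (frac_poly g) by [].
have -> : qfrac pi%:P = in_qpoly (frac_poly f) (tofrac pi)%:P.
  by rewrite /qfrac /= map_polyC.
by rewrite -zE tofracXn polyC_exp in_qpolyM !rmorphXn.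
Qed.

Lemma poly_orderE : poly_order f = range qfrac.
Proof. by []. Qed.

(** With [iota] the embedding of A or the identity of K, this is one or the other span in
    [is_order]. *)
Definition gspan (C : Type) (iota : C -> K) s : set B :=
  [set \sum_(i < size s) iota (c i) *: s`_i | c in [set: nat -> C]].

Lemma gspan_cat (C : Type) (iota : C -> K) s1 s2 z : gspan iota (s1 ++ s2) z <->
  exists x y, [/\ gspan iota s1 x, gspan iota s2 y & z = x + y].
Proof.
split=> [[c _ <-]|[x [y [[c _ <-] [c' _ <-] ->]]]].
  exists (\sum_(i < size s1) iota (c i) *: s1`_i).
  exists (\sum_(i < size s2) iota (c (size s1 + i)%N) *: s2`_i); split.
  - by exists c.
  - by exists (fun i => c (size s1 + i)%N).
  rewrite size_cat big_split_ord /=; congr (_ + _); apply: eq_bigr => i _.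
    by rewrite nth_cat ltn_ord.
  by rewrite nth_cat ltnNge leq_addr addKn.
exists (fun i => if (i < size s1)%N then c i else c' (i - size s1)%N) => //.
rewrite size_cat big_split_ord /=; congr (_ + _); apply: eq_bigr => i _.
  by rewrite nth_cat ltn_ord.
by rewrite nth_cat ltnNge leq_addr addKn.
Qed.

Lemma gspan_mulr (C : Type) (iota : C -> K) s (y : B) :
  gspan iota [seq x * y | x <- s] = [set x * y | x in gspan iota s].
Proof.
have sE (c : nat -> C) : \sum_(i < size [seq x * y | x <- s])
    iota (c i) *: [seq x * y | x <- s]`_i = (\sum_(i < size s) iota (c i) *: s`_i) * y.
  rewrite size_map mulr_suml; apply: eq_bigr => i _.
  by rewrite (nth_map 0) // scalerAl.
rewrite eqEsubset; split=> [z [c _ <-]|_ [_ [c _ <-] <-]].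
  by rewrite sE; eexists; last by []; exists c.
by exists c.
Qed.

Definition qbasis : seq B := mkseq (fun i => qfrac 'X^i) (size f).-1.

Lemma gspan_qbasisE (c : nat -> K) :
  \sum_(i < size qbasis) c i *: qbasis`_i =
  in_qpoly (frac_poly f) (\poly_(i < (size f).-1) c i).
Proof.
rewrite size_mkseq poly_def rmorph_sum /=; apply: eq_bigr => i _.
by rewrite nth_mkseq // in_qpolyZ /qfrac /= map_polyXn.
Qed.

Lemma gspan_qbasis_frac : gspan (@tofrac A) qbasis = range qfrac.
Proof.
rewrite eqEsubset; split=> [z [c _ <-]|_ [g _ <-]].
  rewrite (gspan_qbasisE (fun i => tofrac (c i))); exists (\poly_(i < (size f).-1) c i) => //.
  congr in_qpoly; apply/polyP => i; rewrite coef_map !coef_poly.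
  by case: ifP => _ //; rewrite raddf0.
have [r rf [h ->]] := qfrac_mod g.
rewrite rmorphD rmorphM qfrac_self mul0r add0r.
exists (fun i => r`_i) => //; rewrite (gspan_qbasisE (fun i => tofrac r`_i)); congr in_qpoly.
apply/polyP => i; rewrite coef_map coef_poly; case: ltnP => // ri.
by rewrite nth_default ?raddf0 // (leq_trans _ ri) // -ltnS prednK // ltnW.
Qed.

Lemma gspan_qbasis_id : gspan id qbasis = [set: B].
Proof.
rewrite eqEsubset; split=> // z _; exists (fun i => (z : {poly K})`_i) => //.
rewrite (gspan_qbasisE (fun i => (z : {poly K})`_i)); apply: val_inj => /=.
have zf : (size (z : {poly K}) < size f)%N.
  have E : size (mk_monic (frac_poly f)) = size f.
    by rewrite mk_monic_frac size_frac_poly.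
  exact: leq_trans (size_mk_monic z) (eq_leq E).
have -> : \poly_(i < (size f).-1) (z : {poly K})`_i = z.
  apply/polyP => i; rewrite coef_poly; case: ltnP => // zi.
  by rewrite nth_default // (leq_trans _ zi) // -ltnS prednK // ltnW.
by apply: Pdiv.CommonRing.rmodp_small; exact: size_mk_monic.
Qed.

(** Each generator has a power of pi as denominator, and there are finitely many of them. *)
Lemma gspan_bounded s : exists N, forall z, gspan (@tofrac A) s z ->
  exists g, qfrac pi%:P ^+ N * z = qfrac g.
Proof.
elim: s => [|x s [N IHs]].
  by exists 0%N => z [c _ <-]; rewrite big_ord0 mulr0; exists 0; rewrite rmorph0.
have [M [g xE]] := qfrac_denom x; exists (M + N)%N => z.
rewrite -cat1s => /gspan_cat[_ [y [[c _ <-] /IHs[h yE] ->]]].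
rewrite big_ord1 -[_`_0]/x; exists (pi%:P ^+ N * (c 0%N)%:P * g + pi%:P ^+ M * h).
have cE : tofrac (c 0%N) *: x = qfrac (c 0%N)%:P * x.
  by rewrite /qfrac /= map_polyC -alg_polyC in_qpolyZ in_qpoly1 -scalerAl mul1r.
rewrite cE !(rmorphD qfrac, rmorphM qfrac, rmorphXn qfrac) -xE -yE exprD; ring.
Qed.

Lemma poly_order_is_order : is_order (poly_order f).
Proof.
rewrite poly_orderE; split.
- by exists 1; rewrite ?rmorph1.
- by move=> _ _ [g _ <-] [h _ <-]; exists (g - h); rewrite ?rmorphB.
- by move=> _ _ [g _ <-] [h _ <-]; exists (g * h); rewrite ?rmorphM.
- exists qbasis; split; first by rewrite -gspan_qbasis_frac.
  by rewrite -gspan_qbasis_id.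
Qed.

Variables (F : fieldType) (red : {rmorphism A -> F}).
Hypothesis red_surj : forall c, exists a, red a = c.
Hypothesis red_ker : forall a, red a = 0 -> exists b, a = pi * b.
Hypothesis red_pi : red pi = 0.

(** For f bad, the powers of x together with their multiples by the y of [dedekind_bad_overring]
    generate a strictly larger order, over A and over K. Conversely, finite generation gives a
    larger order the common denominator pi^N that [overring_dedekind_bad] asks for. *)
Theorem dedekind_criterion :
  is_maximal_order (poly_order f) <-> ~ dedekind_bad red pi f.
Proof.
have ker g := @qfrac_ker g.
split=> [[_ max] bad|good].
  have [y [[TO TB TM] yO]] := dedekind_bad_overring red_pi f_monic ker qfrac_self qinvK bad.
  pose s := qbasis ++ [seq x * y | x <- qbasis].
  have TE C iota : gspan iota s = [set z : B | exists a b : B,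
      [/\ gspan (C := C) iota qbasis a, gspan iota qbasis b & z = a + b * y]].
    rewrite eqEsubset; split=> z.
      by move=> /gspan_cat[a [c [aP]]]; rewrite gspan_mulr => -[b bP <-] ->; exists a, b.
    move=> [a [b [aP bP ->]]]; apply/gspan_cat; exists a, (b * y); split=> //.
    by rewrite gspan_mulr; exists b.
  suff TOE : [set z | exists a b, z = qfrac a + qfrac b * y] = poly_order f.
    have : [set z | exists a b, z = qfrac a + qfrac b * y] y.
      by exists 0, 1; rewrite rmorph0 rmorph1 mul1r add0r.
    by rewrite TOE poly_orderE => -[g _ gy]; case: (yO g).
  apply: max; last by move=> _ [g _ <-]; exact: TO.
  split=> //; first by have := TO 1; rewrite rmorph1.
  exists s; split.
    rewrite -/(gspan (@tofrac A) s) TE gspan_qbasis_frac eqEsubset; split=> z.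
      by move=> [a [b ->]]; exists (qfrac a), (qfrac b); split=> //.
    by move=> [_ [_ [[a _ <-] [b _ <-] ->]]]; exists a, b.
  rewrite -/(gspan id s) TE gspan_qbasis_id eqEsubset; split=> // z _.
  by exists z, 0; split=> //; rewrite mul0r addr0.
split; first exact: poly_order_is_order.
move=> T [T1 TB TM [s [TE _]]] OT; apply: contrapT => TO; apply: good.
have [N TN] := gspan_bounded s.
apply: (overring_dedekind_bad red_surj red_ker red_pi f_monic ker qfrac_self qinvK
  (T := T) (N := N)).
- by split=> // g; apply: OT; exists g.
- by move=> z; rewrite TE; exact: TN.
apply: contrapT => H; apply: TO; rewrite eqEsubset; split=> // z Tz.
apply: contrapT => zO; apply: H; exists z => // g gz; apply: zO.
by rewrite poly_orderE; exists g.
Qed.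

End FractionDenominators.

(** * Reduction of p-adic integers *)

Section PadicReduction.
Variables (p : nat) (p_pr : prime p).
Local Notation Zp := (padic_int p_pr).
Implicit Types (x y : Zp).

Lemma intr_modp (a : int) : ((a %% p)%Z)%:~R = a%:~R :> 'F_p.
Proof.
rewrite [in RHS](divz_eq a p) [RHS]intrD [in RHS]intrM -(pmulrn 1 p).
by rewrite (pchar_Fp_0 p_pr) mulr0 add0r.
Qed.

Fact padic_modp_zmod : zmod_morphism (@padic_modp p p_pr).
Proof.
move=> x y; rewrite /padic_modp /= !expn1 intr_modp intrD intr_modp mulrNz.
by [].
Qed.

Fact padic_modp_monoid : monoid_morphism (@padic_modp p p_pr).
Proof.
split; first by rewrite /padic_modp /= expn1 intr_modp.
by move=> x y; rewrite /padic_modp /= expn1 intr_modp intrM.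
Qed.

HB.instance Definition _ :=
  GRing.isZmodMorphism.Build Zp 'F_p (@padic_modp p p_pr) padic_modp_zmod.
HB.instance Definition _ :=
  GRing.isMonoidMorphism.Build Zp 'F_p (@padic_modp p p_pr) padic_modp_monoid.

Lemma padic_natE n k : (n%:R : Zp) k = (n %% p ^ k)%N.
Proof.
elim: n => [|n IHn]; first by rewrite /= mod0n mod0z.
by rewrite -natr1 /= IHn -modz_nat modzDm -PoszD modz_nat addn1.
Qed.

Lemma padic_res_lt x k : 0 <= x k < (p ^ k)%N.
Proof.
rewrite -padic_mod modz_ge0 ?ltz_pmod //.
  by rewrite ltz_nat expn_gt0 prime_gt0.
by rewrite eqz_nat -lt0n expn_gt0 prime_gt0.
Qed.

Lemma padic_modp_eq0 x : padic_modp x = 0 -> x 1 = 0.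
Proof.
have /andP[x0 xp] := padic_res_lt x 1.
rewrite /padic_modp; case: (x 1) x0 xp => // a _; rewrite expn1 ltz_nat => ap.
rewrite -pmulrn => /eqP; rewrite -(dvdn_pcharf (pchar_Fp p_pr)).
by move/dvdn_leq; case: a ap => // a ap /(_ isT); rewrite leqNgt ap.
Qed.

Lemma padic_modp_surj c : exists x, padic_modp x = c.
Proof. by exists (c : nat)%:R; rewrite rmorph_nat natr_Zp. Qed.

Lemma padic_modp_p : padic_modp (p%:R : Zp) = 0.
Proof. by rewrite rmorph_nat (pchar_Fp_0 p_pr). Qed.

Let p0 : (0 < p)%N. Proof. exact: prime_gt0. Qed.

Let pz0 : p%:Z != 0. Proof. by rewrite eqz_nat -lt0n. Qed.

(** Integer division by p drops the lowest digit, so the quotient modulo p^k is read off from x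
    modulo p^(k+1). *)
Lemma padic_shift_subproof x k :
  ((x k.+1 %/ p)%Z %% (p ^ k)%N)%Z = ((x k.+2 %/ p)%Z %% (p ^ k)%N)%Z.
Proof.
rewrite [x k.+2](divz_eq _ (p ^ k.+1)%N) -padic_resP.
rewrite expnSr PoszM mulrA divzMDl // modzMDl //.
Qed.

Lemma padic_modp_ker x : padic_modp x = 0 -> exists y, x = p%:R * y.
Proof.
move/padic_modp_eq0 => x1; exists (padic_of p_pr (padic_shift_subproof x)).
apply: padic_eqP => k; rewrite /= padic_natE -modz_nat modzMm mulrC divzK.
  by rewrite -padic_resP.
apply/dvdz_mod0P; rewrite -[RHS]x1 -(padic_resD x 1 k) add1n.
by rewrite expn1.
Qed.

Lemma padic_p_neq0 : p%:R != 0 :> Zp.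
Proof.
apply/eqP => /(congr1 (fun z : Zp => z 2)); rewrite padic_natE /= mod0z => /eqP.
rewrite eqz_nat modn_small; first by rewrite eqn0Ngt p0.
by rewrite expnS expn1 ltn_Pmull ?prime_gt1.
Qed.

(** Bezout inverts x modulo each p^k; inverses are unique there, so the chosen ones are coherent. *)
Lemma padic_inverse x : padic_modp x != 0 -> exists y, x * y = 1.
Proof.
move=> x0; have cop k : coprimez (x k) (p ^ k)%N.
  case: k => [|k]; first by rewrite /coprimez expn0 gcdz1.
  rewrite coprimezE /= coprimeXr // coprime_sym prime_coprime //.
  apply: contra x0 => px; rewrite /padic_modp -(padic_resD x 1 k) add1n expn1.
  have /dvdz_mod0P -> : (p %| x k.+1)%Z by [].
  by rewrite mulr0z.
have inv k : exists u : int, (u * x k = 1 %[mod (p ^ k)%N])%Z.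
  have [u [v uv]] := Bezoutz (x k) (p ^ k)%N; exists u.
  by move/eqP: (cop k) => <-; rewrite -uv addrC modzMDl.
have [u uE] := choice inv.
have uP k : (u k %% (p ^ k)%N)%Z = (u k.+1 %% (p ^ k)%N)%Z.
  have E : (u k.+1 * x k = 1 %[mod (p ^ k)%N])%Z.
    have := congr1 (fun a => (a %% (p ^ k)%N)%Z) (uE k.+1).
    by rewrite !modz_expS (padic_resP x k) modzMmr.
  rewrite -[u k]mulr1 -modzMmr -E modzMmr mulrCA -modzMmr (uE k) modzMmr mulr1.
  by [].
exists (padic_of p_pr uP); apply: padic_eqP => k /=.
by rewrite modzMmr mulrC uE.
Qed.

(** Induction on a k with x <> 0 modulo p^k: dividing by p lowers k, and an x prime to p is
    invertible. *)
Lemma padic_denom x : x != 0 -> exists N y, p%:R ^+ N = x * y.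
Proof.
move=> /padic_neq0[k]; elim: k x => [|k IHk] x xk.
  by move: xk; rewrite padic_resP expn0 modz1 eqxx.
have [/padic_modp_ker[y xE]|/padic_inverse[y xy]] := eqVneq (padic_modp x) 0; last first.
  by exists 0%N, y; rewrite expr0 xy.
have [|N [z yE]] := IHk y.
  apply: contra xk => /eqP yk; rewrite xE /= padic_natE -modz_nat modzMml.
  apply/eqP/dvdz_mod0P; rewrite expnS PoszM dvdz_mul2l ?pz0 //.
  by apply/dvdz_mod0P; rewrite -padic_resP.
by exists N.+1, z; rewrite exprS yE mulrA -xE.
Qed.

Definition fp_lift (c : 'F_p) : Zp := (c : nat)%:R.

Lemma fp_liftK c : padic_modp (fp_lift c) = c.
Proof. by rewrite rmorph_nat natr_Zp. Qed.

Lemma padic_digit x : exists y, x = fp_lift (padic_modp x) + p%:R * y.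
Proof.
have [|y xE] := @padic_modp_ker (x - fp_lift (padic_modp x)).
  by rewrite rmorphB /= fp_liftK subrr.
by exists y; rewrite -xE subrKC.
Qed.

End PadicReduction.

(** * Valuation of the discriminant *)

Section SylvesterRows.
Variables (R : comNzRingType) (a b : nat).
Implicit Types (f g : {poly R}).

(* [Sylvester_mx] with prescribed formal degrees: unlike the degrees of the two
   polynomials, these do not change under reduction. *)
Definition sylv f g : 'M[R]_(a + b) :=
  col_mx (lin1_mx (poly_rV \o f \o* rVpoly)) (lin1_mx (poly_rV \o g \o* rVpoly)).

Definition row2 f g : 'rV[R]_(a + b) := row_mx (poly_rV f) (poly_rV g).

Definition fst_poly (c : 'rV[R]_(a + b)) := rVpoly (lsubmx c).
Definition snd_poly (c : 'rV[R]_(a + b)) := rVpoly (rsubmx c).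

Lemma row2K (c : 'rV[R]_(a + b)) : row2 (fst_poly c) (snd_poly c) = c.
Proof. by rewrite /row2 !rVpolyK hsubmxK. Qed.

Lemma fst_row2 f g : (size f <= a)%N -> fst_poly (row2 f g) = f.
Proof. by move=> fa; rewrite /fst_poly row_mxKl poly_rV_K. Qed.

Lemma snd_row2 f g : (size g <= b)%N -> snd_poly (row2 f g) = g.
Proof. by move=> gb; rewrite /snd_poly row_mxKr poly_rV_K. Qed.

Lemma mul_sylv (c : 'rV[R]_(a + b)) f g :
  c *m sylv f g = poly_rV (fst_poly c * f + snd_poly c * g).
Proof.
rewrite -{1}[c]hsubmxK mul_row_col !mul_rV_lin1 /= linearD /=.
by congr (_ + _); congr poly_rV; rewrite mulrC.
Qed.

Lemma rVpoly_mul_sylv (c : 'rV[R]_(a + b)) f g :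
    (size f <= b.+1)%N -> (size g <= a.+1)%N ->
  rVpoly (c *m sylv f g) = fst_poly c * f + snd_poly c * g.
Proof.
move=> fb ga; rewrite mul_sylv poly_rV_K //.
have bound h k i j : (size (h : {poly R}) <= i)%N -> (size (k : {poly R}) <= j.+1)%N ->
    (size (h * k)%R <= i + j)%N.
  move=> hi kj; have [->|h0] := eqVneq h 0; first by rewrite mul0r size_poly0.
  apply: leq_trans (size_polyMleq _ _) _; rewrite -subn1 leq_subLR add1n -addnS.
  exact: leq_add.
apply: leq_trans (size_polyD _ _) _; rewrite geq_max bound ?size_poly //=.
by rewrite addnC bound ?size_poly.
Qed.

Lemma size_snd c : (size (snd_poly c) <= b)%N. Proof. exact: size_poly. Qed.

End SylvesterRows.

Lemma map_sylv (R S : comNzRingType) (h : {rmorphism R -> S}) a b (f g : {poly R}) :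
  map_mx h (sylv a b f g) = sylv a b (map_poly h f) (map_poly h g).
Proof.
rewrite /sylv map_col_mx; congr col_mx; apply/matrixP => i j;
  by rewrite !mxE /= !rVpoly_delta !coefXnM; case: ifP; rewrite ?raddf0 ?coef_map.
Qed.

(** * Determinants with one row replaced *)

Section ReplaceRow.
Variables (R : comNzRingType) (n : nat).
Implicit Types (M : 'M[R]_n) (c z : 'rV[R]_n) (i : 'I_n).

Definition replace_row i z M : 'M[R]_n :=
  \matrix_(k, j) if k == i then z 0 j else M k j.

Lemma det_replace_row i z M : \det (replace_row i z M) = (z *m \adj M) 0 i.
Proof.
rewrite (expand_det_row _ i) !mxE; apply: eq_bigr => j _; rewrite !mxE eqxx.
congr (_ * (_ * \det _)); apply/matrixP => k l; rewrite !mxE.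
by rewrite eq_sym (negPf (neq_lift _ _)).
Qed.

Lemma mul_replace_row c i z M : c *m replace_row i z M =
  (c - c 0 i *: delta_mx 0 i) *m M + c 0 i *: z.
Proof.
apply/rowP => j; rewrite !mxE (bigD1 i) //= [in RHS](bigD1 i) //= !mxE !eqxx.
rewrite mulr1 subrr mul0r add0r addrC; congr (_ + _); apply: eq_bigr => k ki.
by rewrite !mxE (negPf ki) andbF mulr0 subr0.
Qed.

(** Cramer's rule: multiply c M = x z by the adjugate of M and compare the entries of index i. *)
Lemma det_replace_row_scale c i z M x : c *m M = x *: z ->
  c 0 i * \det M = x * \det (replace_row i z M).
Proof.
move=> cM; rewrite det_replace_row.
have := congr1 (fun v => (v *m \adj M) 0 i) cM.
by rewrite -mulmxA mul_mx_adj mul_mx_scalar -scalemxAl !mxE mulrC.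
Qed.

End ReplaceRow.

Lemma map_replace_row (R S : comNzRingType) (h : {rmorphism R -> S}) n i
    (z : 'rV[R]_n) M :
  map_mx h (replace_row i z M) = replace_row i (map_mx h z) (map_mx h M).
Proof. by apply/matrixP => k j; rewrite !mxE; case: ifP. Qed.

Section SylvesterKernel.
Variables (F : fieldType) (a b : nat) (f g : {poly F}).
Hypotheses (f_monic : f \is monic) (fb : size f = b.+1) (ga : (size g <= a.+1)%N).
Local Notation d := (gcdp f g).
Local Notation M := (sylv a b f g).
Let f0 : f != 0 := monic_neq0 f_monic.
Let d0 : d != 0. Proof. by rewrite gcdp_eq0 (negPf f0). Qed.

(** The pair (- g / d, f / d) generates all relations u f + v g = 0, and so describes the kernel of
    the Sylvester matrix. *)
Definition cofst : {poly F} := - (g %/ d).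
Definition cosnd : {poly F} := f %/ d.

Lemma cofactor_syzygy : cofst * f + cosnd * g = 0.
Proof.
transitivity (- (g %/ d) * (f %/ d * d) + f %/ d * (g %/ d * d)); last by ring.
by rewrite !divpK ?dvdp_gcdl ?dvdp_gcdr.
Qed.

Lemma cosnd_neq0 : cosnd != 0.
Proof. by rewrite divp_eq0 !negb_or f0 d0 -leqNgt dvdp_leq // dvdp_gcdl. Qed.

Lemma size_cofactor k : (k < size d)%N ->
  (size cofst <= a.+1 - k)%N /\ (size cosnd <= b.+1 - k)%N.
Proof.
move=> kd; rewrite /cofst /cosnd size_polyN !size_divp // fb.
have kd' : (k <= (size d).-1)%N by rewrite -ltnS prednK // (leq_ltn_trans _ kd).
by split; rewrite leq_sub // leq_sub.
Qed.

Lemma syzygy_multiple u v : (u : {poly F}) * f + v * g = 0 -> exists w,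
  u = w * cofst /\ v = w * cosnd.
Proof.
move=> uv.
have cop : coprimep cosnd (g %/ d) by apply: coprimep_div_gcd; rewrite f0.
have uv' : u * cosnd + v * (g %/ d) = 0.
  apply: (mulIf d0); rewrite mul0r mulrDl -!mulrA !divpK ?dvdp_gcdl ?dvdp_gcdr //.
have : cosnd %| v * (g %/ d).
  by rewrite -(dvdp_addr _ (dvdp_mull u (dvdpp cosnd))) uv' dvdp0.
rewrite Gauss_dvdpl // => /dvdpP[w vE]; exists w; split=> //.
apply: (mulIf cosnd_neq0); move/eqP: uv'; rewrite addr_eq0 => /eqP ->.
by rewrite vE /cofst; ring.
Qed.

(** A kernel vector (u, v) is a multiple of the cofactors. For constant d this makes f divide v,
    which has smaller degree, so both vanish; otherwise the cofactors themselves fit into the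
    prescribed degrees. *)
Lemma sylv_det_eq0 : (\det M == 0) = (1 < size d)%N.
Proof.
apply/det0P/idP => [[c c0 cM]|d1].
  rewrite ltnNge; apply: contra c0 => d1.
  have := rVpoly_mul_sylv c (eq_leq fb) ga; rewrite cM linear0 => /esym.
  case/syzygy_multiple => w [uE vE].
  have fv : f %| snd_poly c.
    rewrite vE /cosnd; have /size_poly1P[k k0 ->] : size d == 1%N.
      by rewrite eqn_leq d1 size_poly_gt0.
    by rewrite -[k%:P]alg_polyC divpZr // divp1 -scalerAr dvdpZr ?invr_eq0 // dvdp_mull.
  have v0 : snd_poly c = 0.
    apply: contraTeq (size_snd c) => v0; rewrite -ltnNge -fb.
    exact: dvdp_leq.
  have w0 : w = 0 by move/eqP: vE; rewrite v0 eq_sym mulf_eq0 (negPf cosnd_neq0) orbF => /eqP.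
  by rewrite -[c]row2K v0 uE w0 mul0r /row2 !linear0 row_mx0.
have [ua vb] := size_cofactor d1; rewrite !subn1 /= in ua vb.
exists (row2 a b cofst cosnd); last first.
  by rewrite mul_sylv fst_row2 // snd_row2 // cofactor_syzygy linear0.
apply: contraNneq cosnd_neq0 => c0.
by rewrite -(snd_row2 a cofst vb) c0 /snd_poly linear0 linear0.
Qed.

End SylvesterKernel.

Section SingularReplacement.
Variables (F : fieldType) (a b : nat) (f g : {poly F}).
Hypotheses (f_monic : f \is monic) (fb : size f = b.+1) (ga : (size g <= a.+1)%N).
Local Notation d := (gcdp f g).
Local Notation M := (sylv a b f g).
Local Notation c := (row2 a b (cofst f g) (cosnd f g)).
Variables (i : 'I_(a + b)) (z : 'rV[F]_(a + b)).
Hypothesis ci : c 0 i != 0.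

Let c_syzygy k : (k < size d)%N -> (0 < k)%N ->
  (size (cofst f g) <= a)%N /\ (size (cosnd f g) <= b)%N.
Proof.
move=> kd k0; have [u v] := size_cofactor f_monic fb ga kd.
by split; [apply: leq_trans u _ | apply: leq_trans v _]; rewrite leq_subLR -addn1 addnC leq_add2r.
Qed.

Let row2D (u v u' v' : {poly F}) : row2 a b (u + u') (v + v') = row2 a b u v + row2 a b u' v'.
Proof. by rewrite /row2 !linearD add_row_mx. Qed.

Let row2Z k (u v : {poly F}) : row2 a b (k *: u) (k *: v) = k *: row2 a b u v.
Proof. by rewrite /row2 !linearZ scale_row_mx. Qed.

(** For deg d >= 2 both c and X c lie in the kernel of the Sylvester matrix. The combination (X - k)
    c with entry i equal to 0 does not see the replaced row. *)
Lemma replace_row_det_gcd_gt2 : (2 < size d)%N -> \det (replace_row i z M) = 0.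
Proof.
move=> d2; apply/eqP/det0P.
have [ua vb] := size_cofactor f_monic fb ga d2; rewrite !subSS !subn1 in ua vb.
pose k := row2 a b ('X * cofst f g) ('X * cosnd f g) 0 i / c 0 i.
pose h : {poly F} := 'X - k%:P.
have hE e : h * e = 'X * e + (- k) *: e by rewrite mulrBl mul_polyC scaleNr.
pose c2 := row2 a b (h * cofst f g) (h * cosnd f g).
have c2i : c2 0 i = 0.
  by rewrite /c2 !hE row2D row2Z mxE [X in _ + X]mxE mulNr divfK ?subrr.
have hs (e : {poly F}) m : (size e <= m.-1)%N -> (size (h * e)%R <= m)%N.
  move=> em; have [->|e0] := eqVneq e 0; first by rewrite mulr0 size_poly0.
  have m0 : (0 < m)%N by case: m em => //; rewrite leqNgt size_poly_gt0 e0.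
  by rewrite size_mul ?polyXsubC_eq0 // size_XsubC add2n /= -(prednK m0) ltnS.
have ha : (size (h * cofst f g)%R <= a)%N by apply: hs.
have hb : (size (h * cosnd f g)%R <= b)%N by apply: hs.
exists c2.
  have : h * cosnd f g != 0 by rewrite mulf_neq0 ?polyXsubC_eq0 ?cosnd_neq0.
  apply: contraNneq => c20; rewrite -(snd_row2 a (h * cofst f g) hb) -/c2 c20.
  by rewrite /snd_poly linear0 linear0.
rewrite mul_replace_row c2i !scale0r subr0 addr0 mul_sylv fst_row2 // snd_row2 //.
by rewrite -!mulrA -mulrDr cofactor_syzygy mulr0 linear0.
Qed.

(** The rows that remain are polynomials vanishing at r. If z(r) = 0 too, the row space misses 1. If
    z(r) <> 0, a kernel vector has entry i zero, hence lies in the kernel of the Sylvester matrix,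
    the line through c; but entry i of c is nonzero. *)
Lemma replace_row_det_gcd2 r : size d = 2%N -> root f r -> root g r ->
  (\det (replace_row i z M) == 0) = root (rVpoly z) r.
Proof.
move=> d2 fr gr; have [ua vb] := @c_syzygy 1%N (eq_leq (esym d2)) isT.
pose N := replace_row i z M.
have rowN e : rVpoly (e *m N) = rVpoly ((e - e 0 i *: delta_mx 0 i) *m M) + e 0 i *: rVpoly z.
  by rewrite mul_replace_row linearD; congr (_ + _); exact: linearZ.
have rootM e : root (rVpoly (e *m M)) r.
  rewrite rVpoly_mul_sylv ?fb // /root hornerD !hornerM.
  by rewrite (eqP fr) (eqP gr) !mulr0 addr0.
apply/det0P/idP => [[e e0 eN]|zr].
  have := congr1 (fun x => (rVpoly x).[r]) eN; rewrite rowN linear0 horner0.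
  rewrite hornerD (eqP (rootM _)) add0r hornerZ => /eqP; rewrite mulf_eq0.
  case/orP=> // /eqP ei; move: eN; rewrite /N mul_replace_row ei !scale0r subr0 addr0.
  move=> eM; have := rVpoly_mul_sylv e (eq_leq fb) ga; rewrite eM linear0 => /esym.
  case/(syzygy_multiple f_monic) => w [uE vE].
  have [w0|w0] := eqVneq w 0.
    by case/eqP: e0; rewrite -[e]row2K uE vE w0 !mul0r /row2 !linear0 row_mx0.
  have w1 : (size w <= 1)%N.
    have := size_snd e; rewrite vE size_mul ?cosnd_neq0 // /cosnd size_divp; last first.
      by rewrite -size_poly_gt0 d2.
    by rewrite fb d2 subn1 /= -subn1 leq_subLR leq_add2r.
  have [k wE] : exists k, w = k%:P.
    by exists w`_0; apply: size1_polyC.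
  have eE : e = k *: c by rewrite -[e]row2K uE vE wE !mul_polyC row2Z.
  move: ei; rewrite eE mxE => /eqP; rewrite mulf_eq0 (negPf ci) orbF => /eqP k0.
  by case/eqP: w0; rewrite wE k0.
apply/det0P; apply: contraTT isT => detN.
have Nu : N \in unitmx by rewrite unitmxE unitfE.
have ab : (0 < a + b)%N by case: (i) => /= m; apply: leq_trans.
have := rowN (poly_rV 1 *m invmx N); rewrite -mulmxA mulVmx // mulmx1.
rewrite poly_rV_K ?size_poly1 // => /(congr1 (fun x => x.[r])).
rewrite hornerC hornerD (eqP (rootM _)) hornerZ (eqP zr) mulr0 addr0 => /eqP.
by rewrite oner_eq0.
Qed.

End SingularReplacement.

Section SylvesterValuation.
Variables (A : idomainType) (F : fieldType) (red : {rmorphism A -> F}) (pi : A).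
Hypothesis red_surj : forall c, exists a, red a = c.
Hypothesis red_ker : forall a, red a = 0 -> exists b, a = pi * b.
Hypothesis red_pi : red pi = 0.
Hypothesis pi_neq0 : pi != 0.
Local Notation rp := (map_poly red).
Variables (a b : nat) (f g : {poly A}).
Hypotheses (f_monic : f \is monic) (fb : size f = b.+1) (ga : (size g <= a.+1)%N).
Local Notation M := (sylv a b f g).
Local Notation d := (gcdp (rp f) (rp g)).
Local Notation c0 := (row2 a b (cofst (rp f) (rp g)) (cosnd (rp f) (rp g))).

Lemma red_mx_surj m n (N : 'M[F]_(m, n)) : exists N', map_mx red N' = N.
Proof.
have [s sE] := choice red_surj; exists (map_mx s N).
by apply/matrixP => i j; rewrite !mxE sE.
Qed.

Lemma red_mx_ker m n (N : 'M[A]_(m, n)) :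
  map_mx red N = 0 -> exists N', N = pi *: N'.
Proof.
move=> N0; have Nij (x : 'I_m * 'I_n) : exists y, N x.1 x.2 = pi * y.
  apply: red_ker; have := congr1 (fun T : 'M[F]_(m, n) => T x.1 x.2) N0.
  by rewrite !mxE.
have [s sE] := choice Nij; exists (\matrix_(i, j) s (i, j)).
by apply/matrixP => i j; rewrite !mxE -sE.
Qed.

Lemma rf_monic : rp f \is monic. Proof. exact: monic_map. Qed.

Lemma size_rf : size (rp f) = b.+1.
Proof. by rewrite size_map_poly_id0 // (monicP f_monic) rmorph1 oner_neq0. Qed.

Lemma size_rg : (size (rp g) <= a.+1)%N.
Proof. exact: leq_trans (size_poly _ _) ga. Qed.

Lemma red_det_sylv : red (\det M) = 0 <-> (1 < size d)%N.
Proof.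
rewrite -(sylv_det_eq0 rf_monic size_rf size_rg) -map_sylv det_map_mx.
by split=> /eqP.
Qed.

Lemma syzygy_lift : (1 < size d)%N -> exists i, exists c, exists z,
  [/\ map_mx red c = c0, c0 0 i != 0 & c *m M = pi *: z].
Proof.
move=> d1; have [ua vb] := size_cofactor rf_monic size_rf size_rg d1.
rewrite !subn1 /= in ua vb.
have [i ci] : exists i, c0 0 i != 0.
  apply: contrapT => H; have cz : c0 = 0.
    apply/rowP => i; rewrite [RHS]mxE; apply: contrapT => /eqP ci.
    by apply: H; exists i.
  have := cosnd_neq0 (rp g) rf_monic; rewrite -(snd_row2 a (cofst (rp f) (rp g)) vb).
  by rewrite cz /snd_poly !linear0 eqxx.
have [c cE] := red_mx_surj c0; exists i, c.
have [z zE] : exists z, c *m M = pi *: z.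
  apply: red_mx_ker; rewrite map_mxM cE map_sylv mul_sylv fst_row2 // snd_row2 //.
  by rewrite cofactor_syzygy linear0.
by exists z.
Qed.

(** Cramer's rule gives c_i det M = pi det N, where N has z as row i and c_i is nonzero modulo pi.
    So a second factor pi in det M amounts to one factor pi in det N. *)
Lemma pi2_dvd_det i c z : map_mx red c = c0 -> c0 0 i != 0 -> c *m M = pi *: z ->
  (exists y, \det M = pi ^+ 2 * y) <->
  \det (replace_row i (map_mx red z) (sylv a b (rp f) (rp g))) = 0.
Proof.
move=> cE ci cM; have detE := det_replace_row_scale i cM.
have rci : red (c 0 i) != 0 by move: ci; rewrite -cE mxE.
rewrite -map_sylv -map_replace_row det_map_mx; split=> [[y My]|/red_ker[y Ny]].
  have -> : \det (replace_row i z M) = pi * (c 0 i * y).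
    by apply: (mulfI pi_neq0); rewrite -detE My; ring.
  by rewrite rmorphM red_pi mul0r.
have redM : red (\det M) = 0.
  apply: (mulfI rci); rewrite mulr0 -rmorphM detE Ny !rmorphM /=.
  by rewrite red_pi mul0r.
have [x Mx] := red_ker redM.
have E : c 0 i * x = pi * y.
  by apply: (mulfI pi_neq0); rewrite -Ny -detE Mx; ring.
have [w xE] : exists w, x = pi * w.
  apply: red_ker; apply: (mulfI rci); rewrite mulr0 -rmorphM E rmorphM /=.
  by rewrite red_pi mul0r.
by exists w; rewrite Mx xE mulrA.
Qed.

Lemma pi2_dvd_det_gt2 : (2 < size d)%N -> exists y, \det M = pi ^+ 2 * y.
Proof.
move=> d2; have [i [c [z [cE ci cM]]]] := syzygy_lift (ltnW d2).
apply/(pi2_dvd_det cE ci cM); exact: replace_row_det_gcd_gt2 rf_monic size_rf size_rg _ _ ci d2.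
Qed.

End SylvesterValuation.

(** * Common factors of a polynomial and its derivative *)

Lemma sqr_dvd_deriv (K : fieldType) (e h : {poly K}) : e ^+ 2 %| h -> e %| h^`().
Proof.
move=> /dvdpP[k ->]; rewrite expr2 derivM derivM.
by rewrite !dvdp_add ?dvdp_mull ?dvdp_add ?dvdp_mulIr ?dvdp_mulIl.
Qed.

Section DoubleRootDerivative.
Variables (F : finFieldType) (f : {poly F}).
Hypothesis f0 : f != 0.
Local Notation d := (gcdp f f^`()).

Lemma gcd_deriv_size2 : size d = 2%N -> exists2 r, d %= 'X - r%:P &
  exists g, f = ('X - r%:P) ^+ 2 * g.
Proof.
move=> d2; have [r dr] := poly2_root d2; exists r.
  rewrite eqp_sym -dvdp_size_eqp ?size_XsubC ?d2 //.
  by rewrite dvdp_XsubCl.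
have rd : 'X - r%:P %| d by rewrite dvdp_XsubCl.
have /dvdpP[h fE] := dvdp_trans rd (dvdp_gcdl _ _).
have := dvdp_trans rd (dvdp_gcdr _ _).
rewrite {1}fE derivM derivXsubC mulr1 dvdp_addr ?dvdp_mull // => /dvdpP[g hE].
by exists g; rewrite fE hE; ring.
Qed.

Lemma deriv_double_root r g :
  (('X - r%:P) ^+ 2 * g)^`() = ('X - r%:P) * ((2%:R : F)%:P * g + ('X - r%:P) * g^`()).
Proof.
rewrite derivM expr2 derivM derivXsubC polyCMn mulr1 mul1r; ring.
Qed.

(** In characteristic 2 the derivative of (X - r)^2 g is (X - r)^2 g', so a common linear factor
    forces a common square. *)
Lemma gcd_deriv_char2 : (2 : F) = 0 -> size d <> 2%N.
Proof.
move=> F2 d2; have [r dr [g fE]] := gcd_deriv_size2 d2.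
have : ('X - r%:P) ^+ 2 %| d.
  rewrite dvdp_gcd fE dvdp_mulIl deriv_double_root F2 polyC0 mul0r add0r mulrA -expr2.
  exact: dvdp_mulIl.
rewrite (eqp_dvdr _ dr) => /dvdp_leq; rewrite polyXsubC_eq0 => /(_ isT).
by rewrite size_sqr ?polyXsubC_eq0 // !size_XsubC.
Qed.

Lemma sqkernel_XsubC r g : f = ('X - r%:P) ^+ 2 * g ->
  double_root_at f r = sqcoprime g 0 && ~~ root g r.
Proof.
move=> fE; rewrite /double_root_at /sqkernel fE mulKp ?expf_neq0 ?polyXsubC_eq0 //.
by rewrite dvdp_mulIl dvdp0 div0p.
Qed.

Lemma gcd_deriv_double_root : (2 : F) != 0 -> size d = 2%N -> exists2 r,
  d %= 'X - r%:P & double_root_at f r.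
Proof.
move=> F2 d2; have [r dr [g fE]] := gcd_deriv_size2 d2; exists r => //.
have Xr0 : 'X - r%:P != 0 by rewrite polyXsubC_eq0.
have gr : ~~ root g r.
  apply/negP; rewrite root_factor_theorem => /dvdpP[h gE].
  have : ('X - r%:P) ^+ 2 %| d.
    rewrite dvdp_gcd fE dvdp_mulIl deriv_double_root gE expr2 dvdp_mul2l //.
    by rewrite dvdp_add // ?dvdp_mulIl // mulrA dvdp_mulIr.
  rewrite (eqp_dvdr _ dr) => /dvdp_leq; rewrite polyXsubC_eq0 => /(_ isT).
  by rewrite size_sqr // !size_XsubC.
rewrite (sqkernel_XsubC fE) gr andbT; apply/sqcoprimeP => e eg _.
have ef : e ^+ 2 %| f by rewrite fE dvdp_mull.
have : e %| 'X - r%:P.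
  rewrite -(eqp_dvdr _ dr) dvdp_gcd sqr_dvd_deriv // andbT.
  by apply: dvdp_trans ef; rewrite expr2 dvdp_mulIl.
rewrite leqNgt => eX; apply: contra gr => e1.
rewrite -dvdp_XsubCl; apply: dvdp_trans (_ : e ^+ 2 %| g) => //.
apply: dvdp_trans (_ : e %| e ^+ 2); last by rewrite expr2 dvdp_mulIl.
have : e %= 'X - r%:P.
  by rewrite -dvdp_size_eqp // eqn_leq dvdp_leq //= size_XsubC.
by rewrite /eqp => /andP[].
Qed.

(** Dividing f and f' by X - r leaves (X - r) g and 2 g + (X - r) g'. These are coprime: at r the
    second is 2 g(r) <> 0, and modulo g it is (X - r) g'. *)
Lemma double_root_gcd r : (forall h : {poly F}, sqcoprime h 0 -> coprimep h h^`()) ->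
  (2 : F) != 0 -> double_root_at f r -> d %= 'X - r%:P.
Proof.
move=> perf F2 fr; have /andP[/and3P[/dvdpP[g fE] _ _] _] := fr.
rewrite mulrC in fE; move: fr; rewrite (sqkernel_XsubC fE) => /andP[gs gr].
have Xr0 : 'X - r%:P != 0 by rewrite polyXsubC_eq0.
rewrite fE deriv_double_root expr2 -mulrA.
apply: eqp_trans (gcdp_mul2l _ _ _) _.
rewrite -[X in _ %= X]mulr1 eqp_mul2l // -/(coprimep _ _) gcdp_eqp1 coprimepMl.
have F2' : (2%:R : F)%:P != 0 by rewrite polyC_eq0.
apply/andP; split.
  rewrite coprimep_sym coprimep_XsubC /root hornerD !hornerM hornerXsubC subrr mul0r.
  by rewrite addr0 hornerC mulf_neq0.
by rewrite coprimep_addl_mul coprimepMr coprimep_XsubC gr perf.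
Qed.

Lemma sqcoprime_double_root r t : double_root_at f r -> sqcoprime f t = ~~ root t r.
Proof.
case/andP=> fr _; have Xr2 : ('X - r%:P) ^+ 2 %| f by case/and3P: fr.
rewrite -dvdp_XsubCl; apply/sqcoprimeP/idP => [h|rt e ef et].
  by apply/negP => rt; have := h _ Xr2 rt; rewrite size_XsubC.
have eX : e %| 'X - r%:P by apply: sqkernel_max fr ef (dvdp0 _).
rewrite leqNgt; apply: contra rt => e1; apply: dvdp_trans et.
suff : e %= 'X - r%:P by case/andP.
rewrite -dvdp_size_eqp // eqn_leq dvdp_leq ?polyXsubC_eq0 //=.
by rewrite size_XsubC.
Qed.

End DoubleRootDerivative.

Section DiscriminantValuation.
Variables (A : idomainType) (F : finFieldType) (red : {rmorphism A -> F}) (pi : A).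
Hypothesis red_surj : forall c, exists a, red a = c.
Hypothesis red_ker : forall a, red a = 0 -> exists b, a = pi * b.
Hypothesis red_pi : red pi = 0.
Hypothesis pi_neq0 : pi != 0.
Hypothesis sqfree_separable : forall h : {poly F}, sqcoprime h 0 -> coprimep h h^`().
Local Notation rp := (map_poly red).
Variables (a b : nat) (f : {poly A}).
Hypotheses (f_monic : f \is monic) (fb : size f = b.+1) (fa : (size f^`() <= a.+1)%N).
Local Notation M := (sylv a b f f^`()).
Local Notation d := (gcdp (rp f) (rp f)^`()).
Let rf0 : rp f != 0. Proof. by rewrite monic_neq0 // monic_map. Qed.

Lemma red_det_sylv_deriv : red (\det M) = 0 <-> (1 < size d)%N.
Proof. by rewrite deriv_map; apply: red_det_sylv. Qed.

Lemma det_sylv_char2 : (2 : F) = 0 -> red (\det M) = 0 ->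
  exists y, \det M = pi ^+ 2 * y.
Proof.
move=> F2 /red_det_sylv_deriv d1; apply: (pi2_dvd_det_gt2 red_surj red_ker) => //.
rewrite -deriv_map ltn_neqAle d1 andbT eq_sym; apply/eqP.
exact: gcd_deriv_char2.
Qed.

(** Only one of the two factors X - r of f is cancelled in f / d, and f' / d is coprime to f / d. *)
Lemma root_cofactors r : d %= 'X - r%:P -> double_root_at (rp f) r ->
  root (cosnd (rp f) (rp f)^`()) r /\ ~~ root (cofst (rp f) (rp f)^`()) r.
Proof.
move=> dr fr; have d0 : d != 0 by rewrite gcdp_eq0 (negPf rf0).
have Xr0 : 'X - r%:P != 0 by rewrite polyXsubC_eq0.
have rc : root (cosnd (rp f) (rp f)^`()) r.
  rewrite -dvdp_XsubCl -(dvdp_mul2r _ _ d0) /cosnd divpK ?dvdp_gcdl //.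
  rewrite (eqp_dvdl _ (eqp_mull _ dr)) -expr2.
  by case/andP: fr => /and3P[].
split=> //; apply/negP => rs.
have := coprimep_div_gcd (p := rp f) (q := (rp f)^`()); rewrite rf0 => /(_ isT).
move/coprimep_root/(_ rc); rewrite /cofst rootN in rs.
by rewrite (eqP rs) eqxx.
Qed.

(** Let rho lift r and f = (X - rho)^2 s + pi t; then f and f' take the values pi t(rho) and pi
    t'(rho) at rho. Evaluating the lifted relation u f + v f' = pi z there gives z(rho) = u(rho)
    t(rho) + v(rho) t'(rho). Modulo pi, v(r) = 0 and u(r) <> 0, so z(r) and t(r) vanish together:
    the former means pi^2 | det M, the latter that f is bad. *)
Lemma det_sylv_val1 : (2 : F) != 0 ->
  red (\det M) = 0 /\ ~ (exists y, \det M = pi ^+ 2 * y) <->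
  double_root (rp f) /\ ~ dedekind_bad red pi f.
Proof.
move=> F2; have rfm : rp f \is monic by apply: monic_map.
have key r : d %= 'X - r%:P -> double_root_at (rp f) r ->
    (exists y, \det M = pi ^+ 2 * y) <-> dedekind_bad red pi f.
  move=> dr fr; have d2 : size d = 2%N by rewrite (eqp_size dr) size_XsubC.
  have d2' : size (gcdp (rp f) (rp f^`())) = 2%N by rewrite -deriv_map.
  have d1 : (1 < size (gcdp (rp f) (rp f^`())))%N by rewrite d2'.
  have [i [c [z [cE ci cM]]]] := syzygy_lift red_surj red_ker f_monic fb fa d1.
  rewrite (pi2_dvd_det red_ker red_pi pi_neq0 cE ci cM).
  have fr0 : root (rp f) r.
    by rewrite -dvdp_XsubCl -(eqp_dvdl _ dr) dvdp_gcdl.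
  have gr0 : root (rp f^`()) r.
    by rewrite -dvdp_XsubCl -deriv_map -(eqp_dvdl _ dr) dvdp_gcdr.
  have detE := replace_row_det_gcd2 (rf_monic red f_monic) (size_rf red f_monic fb)
    (size_rg red fa) (map_mx red z) ci d2' fr0 gr0.
  have [rho rhoE] := red_surj r.
  have mE : rp ('X - rho%:P) = 'X - r%:P.
    by rewrite rmorphB /= map_polyX map_polyC /= rhoE.
  have : rp (('X - rho%:P) ^+ 2) %| rp f.
    by rewrite rmorphXn /= mE; case/andP: (fr) => /and3P[].
  case/(red_poly_dvd red_surj red_ker) => s [t fE].
  have fk : sqkernel (rp f) 0 (rp ('X - rho%:P)) by rewrite mE; case/andP: fr.
  rewrite (dedekind_badP red_surj red_ker red_pi pi_neq0 f_monic fE fk).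
  rewrite (sqcoprime_double_root rf0 _ fr) negbK.
  have [rsnd rfst] := root_cofactors dr fr.
  have Xrho : ('X - rho%:P).[rho] = 0 by rewrite hornerXsubC subrr.
  have fz : f.[rho] = pi * t.[rho].
    by rewrite {1}fE hornerD hornerM horner_exp Xrho hornerM hornerC; ring.
  have gz : f^`().[rho] = pi * t^`().[rho].
    have -> : f^`() = ('X - rho%:P) * (('X - rho%:P) * s^`() + s *+ 2) + pi%:P * t^`().
      by rewrite {1}fE derivD derivM (derivM pi%:P) derivC expr2 derivM derivXsubC; ring.
    by rewrite hornerD hornerM Xrho hornerM hornerC; ring.
  have zE : fst_poly c * f + snd_poly c * f^`() = pi *: rVpoly z.
    by rewrite -(rVpoly_mul_sylv c (eq_leq fb) fa) cM linearZ.
  have : (fst_poly c).[rho] * t.[rho] + (snd_poly c).[rho] * t^`().[rho] =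
      (rVpoly z).[rho].
    apply: (mulfI pi_neq0); rewrite -[RHS]hornerZ -zE hornerD !hornerM fz gz; ring.
  have [ua vb] := size_cofactor rfm (size_rf red f_monic fb) (size_rg red fa) d1.
  rewrite !subn1 /= in ua vb.
  have redz : red (rVpoly z).[rho] = (rVpoly (map_mx red z)).[r].
    by rewrite -map_rVpoly -rhoE horner_map.
  have redt : red t.[rho] = (rp t).[r] by rewrite -rhoE horner_map.
  have redu : red (fst_poly c).[rho] = (cofst (rp f) (rp f)^`()).[r].
    rewrite -rhoE -horner_map /= map_rVpoly map_lsubmx cE rhoE deriv_map.
    by rewrite -[rVpoly _]/(fst_poly _) fst_row2.
  have redv : red (snd_poly c).[rho] = (cosnd (rp f) (rp f)^`()).[r].
    rewrite -rhoE -horner_map /= map_rVpoly map_rsubmx cE rhoE deriv_map.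
    by rewrite -[rVpoly _]/(snd_poly _) snd_row2.
  move/(congr1 red); rewrite rmorphD !rmorphM /= redz redt redu redv (eqP rsnd) mul0r addr0.
  move=> zt; split=> [/eqP|/eqP rt].
    by rewrite detE /root -zt mulf_eq0 => /orP[rf|//]; case/negP: rfst.
  by apply/eqP; rewrite detE /root -zt rt mulr0.
rewrite red_det_sylv_deriv; split=> [[d1 dy]|[/double_rootP[r fr] bad]].
  have d2 : size d = 2%N.
    apply: contrapT => d2; apply: dy.
    apply: (pi2_dvd_det_gt2 red_surj red_ker red_pi pi_neq0 f_monic fb fa).
    by rewrite -deriv_map ltn_neqAle d1 andbT eq_sym; apply/eqP.
  have [r dr fr] := gcd_deriv_double_root F2 d2.
  split; first by apply/double_rootP; exists r.
  by rewrite -(key r dr fr).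
have dr := double_root_gcd sqfree_separable F2 fr.
by rewrite (key r dr fr) (eqp_size dr) size_XsubC.
Qed.

End DiscriminantValuation.

(** * Squarefree polynomials over F_p are separable *)

Section PrimeFieldSeparable.
Variables (p : nat) (p_pr : prime p).
Implicit Types h : {poly 'F_p}.

(** Only exponents divisible by p occur in h, and elements of F_p are their own p-th powers, so h is
    a Frobenius image. *)
Lemma deriv_eq0_exp h : h^`() = 0 -> exists e, h = e ^+ p.
Proof.
move=> h0; have p0 := prime_gt0 p_pr.
have chp : p \in [pchar {poly 'F_p}] by rewrite pchar_poly pchar_Fp.
have coef0 j : ~~ (p %| j)%N -> h`_j = 0.
  case: j => [|j]; first by rewrite dvdn0.
  rewrite (dvdn_pcharf (pchar_Fp p_pr)) => jp.
  have := congr1 (fun e : {poly 'F_p} => e`_j) h0; rewrite coef_deriv coef0 -mulr_natr.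
  by move/eqP; rewrite mulf_eq0 (negPf jp) orbF => /eqP.
exists (\poly_(i < size h) h`_(i * p)).
rewrite poly_def -(pFrobenius_autE chp) rmorph_sum /=.
apply/polyP => j; rewrite coef_sum.
under eq_bigr => i _.
  rewrite pFrobenius_autE exprZn -exprM coefZ coefXn.
  have -> : h`_(i * p) ^+ p = h`_(i * p) by rewrite -[RHS]expf_card card_Fp.
  over.
have [/dvdnP[k ->]|pj] := boolP (p %| j)%N; last first.
  rewrite coef0 // big1 // => i _; case: eqP => [jE|_]; last by rewrite mulr0.
  by rewrite jE dvdn_mull in pj.
have [kh|hk] := ltnP k (size h).
  rewrite (bigD1 (Ordinal kh)) //= eqxx mulr1 big1 ?addr0 // => i ik.
  rewrite eqn_pmul2r // eq_sym; case: eqP => [iE|_]; last by rewrite mulr0.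
  by case/eqP: ik; apply: val_inj.
rewrite nth_default; last by rewrite (leq_trans hk) // leq_pmulr.
rewrite big1 // => i _; rewrite eqn_pmul2r // gtn_eqF ?mulr0 //.
exact: leq_trans (ltn_ord i) hk.
Qed.

Lemma sqfree_separable_Fp h : sqcoprime h 0 -> coprimep h h^`().
Proof.
move=> /sqcoprimeP hsq.
have : separable_poly h; last by rewrite unlock.
apply/separable_polyP; split=> [u v uv|u uh u1].
  rewrite coprimep_def eqn_leq hsq ?dvdp0 //; last first.
    by apply: dvdp_trans uv; rewrite expr2 dvdp_mul ?dvdp_gcdl ?dvdp_gcdr.
  rewrite size_poly_gt0 gcdp_eq0; apply/negP => /andP[/eqP u0 /eqP v0].
  move: uv; rewrite u0 mul0r dvd0p => /eqP h0.
  by have := hsq 'X; rewrite h0 !dvdp0 size_polyX => /(_ isT isT).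
apply/eqP => /deriv_eq0_exp[e uE]; have p2 := prime_gt1 p_pr.
have e1 : (size e <= 1)%N.
  by apply: hsq; rewrite ?dvdp0 //; apply: dvdp_trans uh; rewrite uE dvdp_exp2l.
move: u1; rewrite uE ltnNge => /negP; apply.
have [c ->] : exists c, e = c%:P by exists e`_0; apply: size1_polyC.
by rewrite -polyC_exp size_polyC_leq1.
Qed.

End PrimeFieldSeparable.

(** * The discriminant over the p-adic integers *)

Section PadicDiscriminant.
Variables (p : nat) (p_pr : prime p).
Local Notation Zp := (padic_int p_pr).
Local Notation red := (@padic_modp p p_pr).
Variables (n : nat) (f : {poly Zp}).
Hypotheses (f_monic : f \is monic) (fn : size f = n.+2).

Lemma padic_natr_neq0 k : (0 < k)%N -> k%:R != 0 :> Zp.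
Proof.
move=> k0; apply/eqP => /(congr1 (fun z : Zp => z k)); rewrite padic_natE /= mod0z.
rewrite (modn_small (ltn_expl k (prime_gt1 p_pr))) => /eqP.
by rewrite eqz_nat eqn0Ngt k0.
Qed.

Lemma size_deriv_padic : size f^`() = n.+1.
Proof.
apply/eqP; rewrite eqn_leq; apply/andP; split.
  by have := lt_size_deriv (monic_neq0 f_monic); rewrite fn.
rewrite ltnNge; apply/negP => /leq_sizeP /(_ _ (leqnn n)) /eqP.
rewrite coef_deriv; have := monicP f_monic; rewrite lead_coefE fn /= => ->.
by apply/negP; exact: padic_natr_neq0.
Qed.

(** In characteristic 0 the derivative has degree exactly n, so the formal degrees are the actual
    ones. *)
Lemma discE : disc f = (-1) ^+ 'C(n.+1, 2) * \det (sylv n n.+1 f f^`()).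
Proof.
rewrite /disc fn; congr (_ * _).
have gen a b : (size f^`()).-1 = a -> (size f).-1 = b ->
    resultant f f^`() = \det (sylv a b f f^`()) by move=> <- <-.
by apply: gen; rewrite ?size_deriv_padic ?fn.
Qed.

Let size_deriv_le : (size f^`() <= n.+1)%N. Proof. by rewrite size_deriv_padic. Qed.

Lemma padic_dvd1E (x : Zp) : padic_dvd 1 x <-> red x = 0.
Proof.
split=> [[y ->]|/padic_modp_ker[y ->]]; last by exists y; rewrite expr1.
by rewrite expr1 rmorphM /= padic_modp_p mul0r.
Qed.

Lemma padic_dvd_disc k : padic_dvd k (disc f) <->
  exists y, \det (sylv n n.+1 f f^`()) = p%:R ^+ k * y.
Proof.
have sgn : (-1) ^+ 'C(n.+1, 2) * (-1) ^+ 'C(n.+1, 2) = 1 :> Zp.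
  by rewrite -exprMn mulrNN mul1r expr1n.
rewrite /padic_dvd discE; split=> -[y yE]; exists ((-1) ^+ 'C(n.+1, 2) * y).
  by rewrite mulrCA -yE mulrA sgn mul1r.
by rewrite yE mulrCA.
Qed.

Lemma padic_dvd1_disc : ~ padic_dvd 1 (disc f) <-> sqcoprime (map_poly red f) 0.
Proof.
have dvd1 : padic_dvd 1 (disc f) <-> red (\det (sylv n n.+1 f f^`())) = 0.
  by rewrite padic_dvd_disc -padic_dvd1E.
rewrite dvd1 (red_det_sylv_deriv red f_monic fn size_deriv_le).
set h := map_poly red f; have h0 : h != 0 by rewrite monic_neq0 // monic_map.
split=> [/negP|hs]; last first.
  apply/negP; rewrite -leqNgt; have := sqfree_separable_Fp p_pr hs.
  by rewrite coprimep_def => /eqP ->.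
rewrite -leqNgt => d1; apply/sqcoprimeP => e eh _.
apply: leq_trans d1; apply: dvdp_leq; first by rewrite gcdp_eq0 (negPf h0).
rewrite dvdp_gcd sqr_dvd_deriv // andbT.
by apply: dvdp_trans eh; rewrite expr2 dvdp_mulIl.
Qed.

Lemma padic_val_disc_char2 : p = 2%N -> ~ padic_val_eq (disc f) 1.
Proof.
move=> p2 [/padic_dvd_disc d1 []]; apply/padic_dvd_disc.
apply: (det_sylv_char2 (padic_modp_surj p_pr) (@padic_modp_ker p p_pr)
  (padic_modp_p p_pr) (padic_p_neq0 p_pr) f_monic fn size_deriv_le).
  have := pchar_Fp_0 p_pr; rewrite [in X in X%:R]p2; exact.
by case: d1 => y ->; rewrite rmorphM expr1 /= padic_modp_p mul0r.
Qed.

Lemma padic_val_disc_odd : odd p -> padic_val_eq (disc f) 1 <->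
  double_root (map_poly red f) /\ ~ dedekind_bad red p%:R f.
Proof.
move=> podd; have F2 : (2 : 'F_p) != 0.
  rewrite -(dvdn_pcharf (pchar_Fp p_pr)); apply/negP => /dvdn_leq -/(_ isT) p2.
  by have := prime_gt1 p_pr; case: p p2 podd => [|[|[|]]].
have := det_sylv_val1 (padic_modp_surj p_pr) (@padic_modp_ker p p_pr)
  (padic_modp_p p_pr) (padic_p_neq0 p_pr) (sqfree_separable_Fp p_pr)
  f_monic fn size_deriv_le F2.
move=> <-; rewrite /padic_val_eq !padic_dvd_disc.
have -> : (exists y, \det (sylv n n.+1 f f^`()) = p%:R ^+ 1 * y) <->
    red (\det (sylv n n.+1 f f^`())) = 0 by rewrite -padic_dvd1E.
by [].
Qed.

End PadicDiscriminant.

(** * Haar measure of the residue classes mod p^2 *)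

Section HaarCells.
Variables (p : nat) (p_pr : prime p).
Local Notation Zp := (padic_int p_pr).

Lemma padic_res_eq0 k (x : Zp) : x k = 0 -> exists y, x = p%:R ^+ k * y.
Proof.
elim: k x => [|k IHk] x xk; first by exists x; rewrite expr0 mul1r.
have x1 : padic_modp x = 0.
  by rewrite /padic_modp -(padic_resD x 1 k) add1n xk mod0z mulr0z.
have [y xE] := padic_modp_ker x1.
have [|z yE] := IHk y; last by exists z; rewrite xE yE mulrA -exprS.
have pz : p%:Z != 0 by rewrite eqz_nat -lt0n prime_gt0.
move: xk; rewrite xE /= padic_natE -modz_nat modzMml => /dvdz_mod0P.
rewrite expnS PoszM dvdz_mul2l // => /dvdz_mod0P.
by rewrite -padic_resP.
Qed.

Lemma padic_res_eqP k (x y : Zp) : x k = y k -> exists z, y = x + p%:R ^+ k * z.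
Proof.
move=> xy; have [z zE] : exists z, y - x = p%:R ^+ k * z.
  apply: padic_res_eq0; rewrite /= xy modzDmr subrr mod0z //.
by exists z; rewrite -zE subrKC.
Qed.

Variable m : nat.
Local Notation V := 'rV[Zp]_m.
Local Notation D := ('rV['F_p]_m * 'rV['F_p]_m)%type.

(** The lowest two p-adic digits of each coordinate: the first fixes f mod p, the second the
    perturbation g in f + p g. *)
Definition digits2 (c : D) : V :=
  map_mx (@fp_lift p p_pr) c.1 + p%:R *: map_mx (@fp_lift p p_pr) c.2.

Definition cell (c : D) : set V := [set digits2 c + p%:R ^+ 2 *: y | y in [set: V]].

Lemma row_padic_digit (x : V) : exists y : V,
  x = map_mx (@fp_lift p p_pr) (map_mx (@padic_modp p p_pr) x) + p%:R *: y.
Proof.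
have H i : exists y, x 0 i = fp_lift p_pr (padic_modp (x 0 i)) + p%:R * y.
  exact: padic_digit.
have [y yE] := choice H; exists (\row_i y i).
by apply/rowP => i; rewrite !mxE -yE.
Qed.

Lemma cell_cover (x : V) : exists c, cell c x.
Proof.
have [y xE] := row_padic_digit x; have [z yE] := row_padic_digit y.
exists (map_mx (@padic_modp p p_pr) x, map_mx (@padic_modp p p_pr) y); exists z => //.
by rewrite [RHS]xE [y in RHS]yE /digits2 /= scalerDr addrA expr2 scalerA.
Qed.

Lemma cell_inj (c c' : D) (x : V) : cell c x -> cell c' x -> c = c'.
Proof.
case=> y _ <- [y' _ E].
have e0 i : fp_lift p_pr (c'.1 0 i) + p%:R * (fp_lift p_pr (c'.2 0 i) + p%:R * y' 0 i) =
    fp_lift p_pr (c.1 0 i) + p%:R * (fp_lift p_pr (c.2 0 i) + p%:R * y 0 i).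
  have := congr1 (fun v : V => v 0 i) E; rewrite !mxE expr2 => e.
  by rewrite !mulrDr !addrA !mulrA.
have redE a b : padic_modp (fp_lift p_pr a + p%:R * b) = a.
  by rewrite rmorphD rmorphM /= fp_liftK padic_modp_p mul0r addr0.
have e1 : c'.1 = c.1.
  by apply/rowP => i; have := congr1 (@padic_modp p p_pr) (e0 i); rewrite !redE.
have e2 : c'.2 = c.2.
  apply/rowP => i; have := e0 i; rewrite e1 => /addrI /(mulfI (padic_p_neq0 p_pr)).
  by move/(congr1 (@padic_modp p p_pr)); rewrite !redE.
by case: c c' e1 e2 {E e0} => [? ?] [? ?] /= -> ->.
Qed.

Lemma cell_open c : open (cell c).
Proof.
rewrite openE => _ [y _ <-].
pose x := digits2 c + p%:R ^+ 2 *: y.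
(* A neighbourhood of x for the entrywise topology: the matrices congruent to x modulo p^2. *)
exists (fun i j => [set z : Zp | z 2 = x i j 2]).
  move=> i j; apply: open_nbhs_nbhs; split=> //.
  by move=> z /= zx; exists 2 => t ->.
move=> z /= zx; have H j : exists t, z 0 j = x 0 j + p%:R ^+ 2 * t.
  by apply: padic_res_eqP; rewrite zx.
have [t tE] := choice H; exists (y + \row_j t j) => //.
apply/rowP => j; rewrite scalerDr addrA -/x !mxE -[RHS]/(z 0 j) tE.
by rewrite !mxE.
Qed.

Variable R : realType.
Variable mu : {measure set (borel_rV p_pr m) -> \bar R}.
Hypothesis mu_haar : is_haar mu.

Lemma measurable_open (U : set V) : open U -> measurable (U : set (borel_rV p_pr m)).
Proof. by move=> oU; apply: sub_sigma_algebra. Qed.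

Lemma mu_cell c c' : mu (cell c) = mu (cell c').
Proof.
case: mu_haar => _ _ inv.
rewrite -(inv (digits2 c - digits2 c') (cell c')); last by apply: measurable_open; apply: cell_open.
congr (mu _); rewrite eqEsubset; split=> [_ [y _ <-]|_ [_ [y _ <-] <-]].
  by exists (digits2 c' + p%:R ^+ 2 *: y); [exists y | rewrite addrA subrK].
by exists y => //; rewrite addrA subrK.
Qed.

Lemma mu_cells (s : seq D) : uniq s ->
  mu (\bigcup_(c in [set` s]) cell c) = ((size s)%:R * fine (mu (cell 0)))%:E.
Proof.
move=> us; rewrite measure_fin_bigcup //; last 2 first.
- move=> c c' _ _ [x [xc xc']]; exact: cell_inj xc xc'.
- by move=> c _; apply: measurable_open; apply: cell_open.
have fin : mu (cell 0) \is a fin_num.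
  rewrite ge0_fin_numE //; case: mu_haar => _ muT _.
  apply: le_lt_trans muT; apply: le_measure => //; rewrite inE //.
  by apply: measurable_open; apply: cell_open.
rewrite -fsbig_seq // (eq_bigr (fun=> (fine (mu (cell 0)))%:E)) => [|c _].
  by rewrite sumEFin big_const_seq count_predT iter_addr_0 mulr_natl.
by rewrite /= (mu_cell c 0) fineK.
Qed.

(** Q is a finite union of cells. These are translates of each other, so they have equal measure,
    which is finite and nonzero because the total mass is; the density is the proportion of
    cells. *)
Lemma density_cells (Q : set V) (P : pred D) :
    (forall c y, Q (digits2 c + p%:R ^+ 2 *: y) <-> P c) ->
  fine (mu Q) / fine (mu setT) = #|P|%:R / p%:R ^+ (m + m) :> R.
Proof.
move=> QP.
have QE : Q = \bigcup_(c in [set` enum P]) cell c.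
  rewrite eqEsubset; split=> [x Qx|_ [c + [y _ <-]]].
    have [c cx] := cell_cover x; exists c => //.
    by case: cx Qx => y _ <- /QP Pc; rewrite /= mem_enum.
  by rewrite /= mem_enum => Pc; apply/QP.
have TE : [set: V] = \bigcup_(c in [set` enum {: D}]) cell c.
  rewrite eqEsubset; split=> // x _; have [c cx] := cell_cover x; exists c => //.
  by rewrite /= mem_enum.
have muT : mu setT = ((size (enum {: D}))%:R * fine (mu (cell 0)))%:E.
  by rewrite -mu_cells ?enum_uniq // -TE.
have r0 : fine (mu (cell 0)) != 0.
  case: mu_haar => + _ _; rewrite muT lte_fin => muT0.
  by apply: contraTneq muT0 => ->; rewrite mulr0 ltxx.
rewrite muT [in mu _]QE mu_cells ?enum_uniq //= -!cardE.
rewrite card_prod !card_mx mul1n card_Fp // natrM natrX -exprD.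
by rewrite -mulf_div divff // mulr1.
Qed.

End HaarCells.

(** * Additive characters *)

Section AdditiveCharacters.
Variables (R : realType) (p : nat) (p_pr : prime p).
Local Notation C := R[i].
Implicit Types (chi : {ffun 'F_p -> C}) (b x : 'F_p).

Lemma add_charMn chi x k : add_char chi -> chi (x *+ k) = chi x ^+ k.
Proof.
case=> chi0 chiD; elim: k => [|k IHk]; first by rewrite mulr0n expr0.
by rewrite mulrS chiD IHk exprS.
Qed.

Lemma add_charM chi x b : add_char chi -> chi (x * b) = chi x ^+ b.
Proof.
by move=> chiP; rewrite -(add_charMn _ _ chiP) -mulr_natr natr_Zp.
Qed.

Lemma add_char_expp chi x : add_char chi -> chi x ^+ p = 1.
Proof.
move=> chiP; rewrite -add_charMn // -mulr_natr (pchar_Fp_0 p_pr) mulr0.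
by case: chiP.
Qed.

Lemma sum_add_char chi : add_char chi -> chi != trivial_char R p ->
  \sum_x chi x = 0.
Proof.
move=> chiP chi1; have [y chiy] : exists y, chi y != 1.
  apply: contrapT => H; case/eqP: chi1; apply/ffunP => y; rewrite ffunE.
  by apply: contrapT => /eqP Hy; apply: H; exists y.
have [_ chiD] := chiP.
have E : \sum_x chi x = chi y * \sum_x chi x.
  rewrite mulr_sumr [LHS](reindex_inj (addrI y)).
  by apply: eq_bigr => x _; rewrite chiD.
apply/eqP; move/eqP: E; rewrite -subr_eq0 -{1}[\sum_x _]mul1r -mulrBl mulf_eq0.
by rewrite subr_eq0 eq_sym (negPf chiy).
Qed.

Lemma sum_add_char_exp chi n : add_char chi -> chi != trivial_char R p ->
  \sum_x chi x ^+ n = if (p %| n)%N then p%:R else 0.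
Proof.
move=> chiP chi1; case: ifP => pn.
  have /dvdnP[k ->] := pn.
  under eq_bigr do rewrite mulnC exprM add_char_expp // expr1n.
  by rewrite sumr_const card_Fp.
have n0 : (n%:R : 'F_p) != 0 by rewrite -(dvdn_pcharf (pchar_Fp p_pr)) pn.
rewrite -[RHS](sum_add_char chiP chi1) [RHS](reindex_inj (mulIf n0)).
by apply: eq_bigr => x _; rewrite mulr_natr add_charMn.
Qed.

Lemma unity_roots : exists zs : seq C,
  [/\ uniq zs, size zs = p & forall z, (z \in zs) = (z ^+ p == 1)].
Proof.
have [zs zsE] := closed_field_poly_normal ('X^p - 1 : {poly C}).
have p0 := prime_gt0 p_pr.
have lc : lead_coef ('X^p - 1 : {poly C}) = 1.
  by apply/eqP; rewrite -monicE -polyC1 monicXnsubC.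
rewrite lc scale1r in zsE; exists zs; split.
- rewrite -(separable_prod_XsubC zs) -zsE separable_Xn_sub_1 //.
  by rewrite pnatr_eq0 -lt0n.
- by apply: succn_inj; rewrite -(size_prod_XsubC zs id) -zsE -polyC1 size_XnsubC.
- move=> z; rewrite -root_prod_XsubC -zsE /root.
  by rewrite !hornerE subr_eq0.
Qed.

Definition power_char (z : C) : {ffun 'F_p -> C} := [ffun x : 'F_p => z ^+ x].

Lemma power_char_add z : z ^+ p = 1 -> add_char (power_char z).
Proof.
move=> zp; split=> [|x y]; rewrite !ffunE ?expr0 //.
rewrite -exprD -[RHS](expr_mod _ zp); congr (_ ^+ _).
by congr (_ %% _)%N; exact: Fp_cast.
Qed.

Lemma add_charE chi : add_char chi -> chi = power_char (chi 1).
Proof.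
by move=> chiP; apply/ffunP => x; rewrite ffunE -add_charM // mul1r.
Qed.

Lemma power_char1 z : power_char z 1 = z.
Proof. by rewrite ffunE /= modn_small // expr1. Qed.

Lemma add_char_eq1 chi b : add_char chi -> b != 0 -> chi b = 1 -> chi = trivial_char R p.
Proof.
move=> chiP b0 chib; apply/ffunP => x; rewrite ffunE.
by rewrite -[x](mulVKf b0) add_charM // chib expr1n.
Qed.

(** For b <> 0, multiplication by a p-th root of unity w <> 1 permutes the roots and multiplies the
    sum by w^(-b) <> 1. *)
Lemma sum_power_inv zs b : uniq zs -> size zs = p ->
  (forall z, (z \in zs) = (z ^+ p == 1)) ->
  \sum_(z <- zs) (power_char z b)^-1 = if b == 0 then p%:R else 0.
Proof.
move=> uz sz zsP; case: eqVneq => [->|b0].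
  under eq_bigr do rewrite ffunE expr0 invr1.
  by rewrite big_const_seq count_predT sz iter_addr_0.
have [w wz w1] : exists2 w, w \in zs & w != 1.
  apply: contrapT => H; have : {subset zs <= [:: 1 : C]}.
    move=> z zz; rewrite inE; apply: contrapT => /negP z1; apply: H.
    by exists z.
  by move/(uniq_leq_size uz); rewrite sz leqNgt prime_gt1.
have w0 : w != 0.
  by apply: contraTneq wz => ->; rewrite zsP expr0n eqn0Ngt prime_gt0 // eq_sym oner_eq0.
have wp : w ^+ p = 1 by apply/eqP; rewrite -zsP.
have perm : perm_eq zs [seq w * z | z <- zs].
  have um : uniq [seq w * z | z <- zs] by rewrite map_inj_uniq //; exact: mulfI.
  have sub : {subset [seq w * z | z <- zs] <= zs}.
    by move=> _ /mapP[z + ->]; rewrite !zsP exprMn wp mul1r.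
  have [|_ eqzs] := uniq_min_size um sub; first by rewrite size_map.
  by rewrite perm_sym; apply: uniq_perm.
pose S := \sum_(z <- zs) (power_char z b)^-1.
have E : S = (power_char w b)^-1 * S.
  rewrite {1}/S (perm_big _ perm) big_map mulr_sumr; apply: eq_bigr => z _.
  by rewrite !ffunE exprMn invfM.
have wb : (power_char w b)^-1 != 1.
  rewrite invr_eq1; apply: contra w1 => /eqP wb.
  have := add_char_eq1 (power_char_add wp) b0 wb => /ffunP/(_ 1).
  by rewrite power_char1 ffunE => ->.
apply/eqP; rewrite -/S; move/eqP: E; rewrite -subr_eq0 -{1}[S]mul1r -mulrBl mulf_eq0.
by rewrite subr_eq0 eq_sym (negPf wb).
Qed.

(** A character is determined by its value at 1, any p-th root of unity. The inner sum is the same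
    for all nontrivial characters, p or 0; the outer one is the sum over all characters, p or 0,
    minus the term 1 of the trivial one. *)
Lemma iota_npE n b : iota_np R n b =
  if ~~ (p %| n)%N then 0 else if b != 0 then -1 else p%:R - 1.
Proof.
have [zs [uz sz zsP]] := unity_roots.
pose cs := [seq power_char z | z <- rem 1 zs].
have ucs : uniq cs.
  rewrite map_inj_uniq ?rem_uniq // => z z' /ffunP/(_ 1).
  by rewrite !power_char1.
have z1 : 1 \in zs by rewrite zsP expr1n.
have csE : @add_char R p `\ trivial_char R p = [set` cs].
  rewrite eqEsubset; split=> chi.
    case=> chiP chi1; rewrite /= (add_charE chiP) map_f // mem_rem_uniq // inE.
    rewrite zsP add_char_expp // eqxx andbT; apply/eqP => c1; apply: chi1.
    by rewrite (add_charE chiP) c1; apply/ffunP => x; rewrite !ffunE expr1n.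
  move=> /mapP[z]; rewrite mem_rem_uniq // inE zsP => /andP[zn1 /eqP zp] ->.
  split; first exact: power_char_add.
  move=> /ffunP/(_ 1); rewrite power_char1 ffunE => zE.
  by rewrite zE eqxx in zn1.
have csP chi : chi \in cs -> add_char chi /\ chi != trivial_char R p.
  move=> cc; have : [set` cs] chi by [].
  by rewrite -csE => -[? /eqP].
rewrite /iota_np csE -fsbig_seq //.
have -> : \sum_(chi <- cs) ((chi b)^-1 * \sum_c chi c ^+ n) =
    (\sum_(chi <- cs) (chi b)^-1) * (if (p %| n)%N then p%:R else 0).
  rewrite mulr_suml; apply: eq_big_seq => chi /csP[? ?].
  by rewrite sum_add_char_exp.
case: ifP => pn /=; last by rewrite !mulr0.
have p0 : p%:R != 0 :> C by rewrite pnatr_eq0 -lt0n prime_gt0.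
rewrite mulrC mulfK // big_map.
have := sum_power_inv b uz sz zsP; rewrite (big_rem 1) //= ffunE expr1n invr1.
move/(canRL (addKr _)) => ->; case: eqVneq => _ /=; last by rewrite addr0.
by rewrite addrC.
Qed.

End AdditiveCharacters.

(** * Densities *)

Section TailPolynomials.
Variables (R : comNzRingType) (k : nat).

Definition tail_poly (v : 'rV[R]_k.+1) : {poly R} :=
  \sum_(i < k.+1) v ord0 i *: 'X^(k.+2 - i.+2).

Lemma tail_polyD v w : tail_poly (v + w) = tail_poly v + tail_poly w.
Proof.
rewrite /tail_poly -big_split; apply: eq_bigr => i _.
by rewrite mxE scalerDl.
Qed.

Lemma tail_polyZ c v : tail_poly (c *: v) = c%:P * tail_poly v.
Proof.
rewrite /tail_poly mulr_sumr; apply: eq_bigr => i _.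
by rewrite mxE mul_polyC scalerA.
Qed.

Lemma size_tail_poly v : (size (tail_poly v) <= k.+1)%N.
Proof.
rewrite (leq_trans (size_sum _ _ _)) //; apply/bigmax_leqP => i _.
rewrite (leq_trans (size_scale_leq _ _)) // size_polyXn !subSS ltnS leq_subr //.
Qed.

Lemma coef_tail_poly v (i : 'I_k.+1) : (tail_poly v)`_(k - i) = v 0 i.
Proof.
rewrite coef_sum (bigD1 i) //= coefZ coefXn !subSS eqxx mulr1 big1 ?addr0 // => j ji.
rewrite coefZ coefXn !subSS; case: eqP => [E|_]; last by rewrite mulr0.
case/eqP: ji; apply: val_inj => /=; have := ltn_ord i; have := ltn_ord j.
by rewrite !ltnS => jk ik; rewrite -(subKn jk) -E subKn.
Qed.

Lemma tail_poly_inj : injective tail_poly.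
Proof. by move=> v w vw; apply/rowP => i; rewrite -!coef_tail_poly vw. Qed.

End TailPolynomials.

Lemma map_tail_poly (R S : comNzRingType) (h : {rmorphism R -> S}) k (v : 'rV[R]_k.+1) :
  map_poly h (tail_poly v) = tail_poly (map_mx h v).
Proof.
rewrite rmorph_sum; apply: eq_bigr => i _.
by rewrite /= map_polyZ map_polyXn mxE.
Qed.

Lemma sum_tail_poly (F : finFieldType) (W : nmodType) k (E : {poly F} -> W) :
  \sum_(t <- polys F k.+1) E t = \sum_(v : 'rV[F]_k.+1) E (tail_poly v).
Proof.
rewrite -big_enum -(big_map (@tail_poly F k) xpredT E); apply: perm_big.
have us : uniq [seq tail_poly v | v : 'rV[F]_k.+1].
  by rewrite map_inj_uniq ?enum_uniq //; exact: tail_poly_inj.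
have sub : {subset [seq tail_poly v | v : 'rV[F]_k.+1] <= polys F k.+1}.
  by move=> _ /mapP[v _ ->]; rewrite mem_polys size_tail_poly.
have [|_ e] := uniq_min_size us sub.
  by rewrite size_polys size_map -cardE card_mx mul1n.
by rewrite perm_sym; apply: uniq_perm => //; exact: polys_uniq.
Qed.

Section Densities.
Variables (R : realType) (p : nat) (p_pr : prime p) (k : nat).
Local Notation Zp := (padic_int p_pr).
Local Notation red := (@padic_modp p p_pr).
Local Notation n := k.+2.
Variable b1 : Zp.
Local Notation b := (red b1).
Variable mu : {measure set (borel_rV p_pr n.-1) -> \bar R}.
Hypothesis mu_haar : is_haar mu.
Local Notation q := (#|'F_p|%:R : R).
Implicit Types (a y : 'rV[Zp]_k.+1) (v : 'rV['F_p]_k.+1).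

Lemma monic_a1E a : @monic_a1 p p_pr n b1 a = 'X^n + (b1 *: 'X^(k.+1) + tail_poly a).
Proof. by rewrite /monic_a1 addrA. Qed.

Lemma size_monic_a1_tail a : (size (b1 *: 'X^(k.+1) + tail_poly a)%R <= n)%N.
Proof.
rewrite (leq_trans (size_polyD _ _)) // geq_max (leq_trans (size_scale_leq _ _)).
  by rewrite (leq_trans (size_tail_poly _)).
by rewrite size_polyXn.
Qed.

Lemma size_monic_a1 a : size (@monic_a1 p p_pr n b1 a) = n.+1.
Proof.
by rewrite monic_a1E size_polyDl size_polyXn // ltnS size_monic_a1_tail.
Qed.

Lemma monic_monic_a1 a : @monic_a1 p p_pr n b1 a \is monic.
Proof.
rewrite monicE monic_a1E lead_coefDl ?lead_coefXn //.
by rewrite size_polyXn ltnS size_monic_a1_tail.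
Qed.

Definition red_monic v : {poly 'F_p} := 'X^n + (b *: 'X^(k.+1) + tail_poly v).

Lemma red_monic_inj : injective red_monic.
Proof. by move=> v w /addrI /addrI /tail_poly_inj. Qed.

Lemma red_monic_a1 a : map_poly red (@monic_a1 p p_pr n b1 a) = red_monic (map_mx red a).
Proof.
by rewrite monic_a1E !rmorphD /= map_polyZ !map_polyXn map_tail_poly.
Qed.

Lemma monic_a1_digits c y : @monic_a1 p p_pr n b1 (digits2 p_pr c + p%:R ^+ 2 *: y) =
  @monic_a1 p p_pr n b1 (map_mx (@fp_lift p p_pr) c.1) + p%:R%:P *
    (tail_poly (map_mx (@fp_lift p p_pr) c.2) + p%:R%:P * tail_poly y).
Proof.
rewrite !monic_a1E /digits2 !tail_polyD !tail_polyZ rmorphXn /=; ring.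
Qed.

Lemma map_lift v : map_mx red (map_mx (@fp_lift p p_pr) v) = v.
Proof. by apply/rowP => i; rewrite !mxE fp_liftK. Qed.

Lemma red_monic_digits c y :
  map_poly red (@monic_a1 p p_pr n b1 (digits2 p_pr c + p%:R ^+ 2 *: y)) = red_monic c.1.
Proof.
rewrite monic_a1_digits rmorphD rmorphM /= (red_polyC (padic_modp_p p_pr)) mul0r addr0.
by rewrite red_monic_a1 map_lift.
Qed.

(** The correction has to be a function of the reduced polynomial, as the counts are sums over
    polynomials. Since [red_monic] is injective, the reduction determines the first digits and hence
    the lift. *)
Lemma dedekind_bad_digits : exists tau : {poly 'F_p} -> {poly 'F_p}, forall c y,
  dedekind_bad red p%:R (@monic_a1 p p_pr n b1 (digits2 p_pr c + p%:R ^+ 2 *: y)) <->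
  ~~ sqcoprime (red_monic c.1) (tau (red_monic c.1) + tail_poly c.2).
Proof.
pose f0 v := @monic_a1 p p_pr n b1 (map_mx (@fp_lift p p_pr) v).
have H h : exists t, forall v, red_monic v = h -> forall g,
    f0 v + p%:R%:P * g \is monic -> dedekind_bad red p%:R (f0 v + p%:R%:P * g) <->
    ~~ sqcoprime h (t + map_poly red g).
  have [[v vh]|nv] := pselect (exists v, red_monic v = h); last first.
    (* A default value for the polynomials that are not reductions. *)
    by exists 0 => v vh; case: nv; exists v.
  have [t tP] := dedekind_bad_shift (padic_modp_surj p_pr) (@padic_modp_ker p p_pr)
    (padic_modp_p p_pr) (padic_p_neq0 p_pr) (monic_monic_a1 (map_mx (@fp_lift p p_pr) v)).
  exists (map_poly red t) => w wh g gm.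
  have vw : w = v by apply: red_monic_inj; rewrite wh vh.
  rewrite vw in gm *; have := tP g gm.
  by rewrite red_monic_a1 map_lift vh.
have [tau tauP] := choice H; exists tau => c y.
rewrite monic_a1_digits (tauP _ c.1 erefl).
  by rewrite rmorphD rmorphM /= (red_polyC (padic_modp_p p_pr)) mul0r addr0
             map_tail_poly map_lift.
by rewrite -monic_a1_digits monic_monic_a1.
Qed.

(** The first digits run through the f with [nextc f] equal to b, the second ones through the t,
    each with k + 1 free coefficients. *)
Lemma density_count (Q : set {poly Zp}) (G : {poly 'F_p} -> {poly 'F_p} -> bool) :
    (forall c y, Q (@monic_a1 p p_pr n b1 (digits2 p_pr c + p%:R ^+ 2 *: y)) <->
                 G (red_monic c.1) (tail_poly c.2)) ->
  density b1 mu Q = (\sum_(f <- monics 'F_p n | nextc f == b)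
    \sum_(t <- polys 'F_p k.+1 | G f t) 1) / q ^+ (k.+1 + k.+1).
Proof.
move=> QG; rewrite /density.
have := density_cells mu_haar (Q := [set a | Q (monic_a1 b1 a)])
  (P := fun c => G (red_monic c.1) (tail_poly c.2)).
move=> ->; last exact: QG.
rewrite card_Fp //; congr (_ / _).
rewrite sum_monics_nextc sum_tail_poly.
under [RHS]eq_bigr do rewrite big_mkcond sum_tail_poly.
rewrite pair_big /= -sum1_card natr_sum [LHS]big_mkcond.
by apply: eq_bigr => c _; case: ifP.
Qed.

End Densities.

Section DensityValues.
Variables (R : realType) (p : nat) (p_pr : prime p) (k : nat).
Local Notation Zp := (padic_int p_pr).
Local Notation red := (@padic_modp p p_pr).
Local Notation n := k.+2.
Variable b1 : Zp.
Local Notation b := (red b1).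
Variable mu : {measure set (borel_rV p_pr n.-1) -> \bar R}.
Hypothesis mu_haar : is_haar mu.
Local Notation q := (p%:R : R).

Let q0 : q != 0. Proof. by rewrite pnatr_eq0 -lt0n prime_gt0. Qed.

Lemma Fp2_eq0 : ((2 : 'F_p) == 0) = (p == 2%N).
Proof. by rewrite -(dvdn_pcharf (pchar_Fp p_pr)) dvdn_prime2. Qed.

Lemma maximal_order_digits : exists tau : {poly 'F_p} -> {poly 'F_p}, forall c y,
  is_maximal_order (poly_order (@monic_a1 p p_pr n b1 (digits2 p_pr c + p%:R ^+ 2 *: y))) <->
  sqcoprime (red_monic b1 c.1) (tau (red_monic b1 c.1) + tail_poly c.2).
Proof.
have [tau tauP] := dedekind_bad_digits k b1; exists tau => c y.
set f := monic_a1 b1 _; have fm : f \is monic by exact: monic_monic_a1.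
have f1 : (1 < size f)%N by rewrite size_monic_a1.
rewrite (dedekind_criterion (@padic_denom p p_pr) fm f1 (padic_p_neq0 p_pr)
  (padic_modp_surj p_pr) (@padic_modp_ker p p_pr) (padic_modp_p p_pr)).
by rewrite tauP; split=> [/negP|sq]; [rewrite negbK | apply/negP; rewrite negbK].
Qed.

Lemma P_maxE : P_max n b1 mu =
  if p == 2%N then 1 - (if k is m.+1 then (q ^+ 2)^-1 else (b == 0)%:R / 2)
  else 1 - (q ^+ 2)^-1.
Proof.
have [tau tauP] := maximal_order_digits.
rewrite /P_max (density_count mu_haar (G := fun f t => sqcoprime f (tau f + t))) //.
have qk m : q ^+ m != 0 by rewrite expf_neq0.
case: eqP => [p2|/eqP]; last first.
  rewrite -Fp2_eq0 => F2; rewrite sum_sqcoprime_odd // card_Fp //.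
  by rewrite exprD !exprS; field; rewrite q0 qk.
have F2 : (2 : 'F_p) = 0 by apply/eqP; rewrite Fp2_eq0 p2.
rewrite sum_sqcoprime_even // card_Fp //.
have q2 : q = 2 by rewrite p2.
case: (k) => [|m]; last by rewrite exprD !exprS; field; rewrite q0 qk.
by rewrite q2 /= addn1 !expr1; field.
Qed.

Lemma P0_sqfE : P0_sqf n b1 mu =
  if p == 2%N then 1 - (if k is m.+1 then q^-1 else (b == 0)%:R) else 1 - q^-1.
Proof.
rewrite /P0_sqf (density_count mu_haar (G := fun f t => sqcoprime f 0)); last first.
  move=> c y; rewrite -(red_monic_digits b1 c y).
  apply: padic_dvd1_disc; [exact: monic_monic_a1 | exact: size_monic_a1].
have -> : \sum_(f <- monics 'F_p n | nextc f == b)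
    \sum_(t <- polys 'F_p k.+1 | sqcoprime f 0) 1 = #|'F_p|%:R ^+ k.+1 * sqcount R 0 n b.
  rewrite sqcount0E mulr_sumr [RHS]big_mkcondr; apply: eq_bigr => f _.
  case: ifP => _; last by rewrite big_pred0_eq.
  by rewrite sum_polys1 mulr1.
have qk m : q ^+ m != 0 by rewrite expf_neq0.
case: eqP => [p2|/eqP]; last first.
  rewrite -Fp2_eq0 => F2; rewrite sqfree_count_odd // card_Fp //.
  by rewrite exprD !exprS; field; rewrite q0 qk.
have F2 : (2 : 'F_p) = 0 by apply/eqP; rewrite Fp2_eq0 p2.
rewrite sqfree_count_even // card_Fp //.
case: (k) => [|m]; last by rewrite exprD !exprS; field; rewrite q0 qk.
by rewrite /= addn1 !expr1; field.
Qed.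

Lemma P1_sqf_char2 : p = 2%N -> P1_sqf n b1 mu = 0.
Proof.
move=> p2; rewrite /P1_sqf (density_count mu_haar (G := fun f t => false)).
  by rewrite big1 ?mul0r // => f _; rewrite big_pred0_eq.
move=> c y; split=> // fv; exfalso; move: fv.
apply: padic_val_disc_char2 => //; [exact: monic_monic_a1 | exact: size_monic_a1].
Qed.

Lemma P1_sqf_odd : odd p -> P1_sqf n b1 mu = (q - 1) / q ^+ n *
  if k == 0%N then 1 else (q - 1) / (q + 1) * (q ^+ k - (-1) ^+ k) + (-1) ^+ k *
    (if ~~ (p %| n)%N then 0 else if b != 0 then -1 else q - 1).
Proof.
move=> podd; have [tau tauP] := dedekind_bad_digits k b1.
have F2 : (2 : 'F_p) != 0 by rewrite Fp2_eq0; apply: contraTneq podd => ->.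
rewrite /P1_sqf (density_count mu_haar
  (G := fun f t => double_root f && sqcoprime f (tau f + t))); last first.
  move=> c y; rewrite /= (padic_val_disc_odd (monic_monic_a1 _ _) (size_monic_a1 _ _) podd).
  rewrite red_monic_digits tauP; split=> [[-> /negP]|/andP[-> ->]]; last by split=> // /negP.
  by rewrite negbK.
have -> : \sum_(f <- monics 'F_p n | nextc f == b)
    \sum_(t <- polys 'F_p k.+1 | double_root f && sqcoprime f (tau f + t)) (1 : R) =
    \sum_(f <- monics 'F_p n | (nextc f == b) && double_root f)
    \sum_(t <- polys 'F_p k.+1 | sqcoprime f (tau f + t)) 1.
  rewrite [RHS]big_mkcondr; apply: eq_bigr => f _.
  by case: double_root => //=; rewrite big_pred0_eq.
rewrite sum_double_root sum_sqfree_nroot_count // card_Fp // -(dvdn_pcharf (pchar_Fp p_pr)).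
have qk m : q ^+ m != 0 by rewrite expf_neq0.
set J := (if k == 0%N then _ else _).
by rewrite exprD !exprS; field; rewrite q0 qk.
Qed.

End DensityValues.

Theorem theorem3p1 (R : realType) (n p : nat) (n_ge2 : (2 <= n)%N)
    (p_pr : prime p) (b1 : padic_int p_pr)
    (mu : {measure set (borel_rV p_pr n.-1) -> \bar R})
    (mu_haar : is_haar mu) :
  [/\ P_max n b1 mu =
        (if (n == 2%N) && (p == 2%N) then
           if `[< padic_dvd 1 b1 >] then 1 / 2 else 1
         else 1 - 1 / p%:R ^+ 2),
      P0_sqf n b1 mu =
        (if (n == 2%N) && (p == 2%N) then
           if `[< padic_dvd 1 b1 >] then 0 else 1
         else 1 - 1 / p%:R),
      p = 2%N -> P1_sqf n b1 mu = 0,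
      odd p ->
        ((P1_sqf n b1 mu)%:C)%C =
        (if n == 2%N then
           (p%:R - 1) / p%:R ^+ 2
         else
           (p%:R - 1) ^+ 2 / (p%:R ^+ 2 * (p%:R + 1))
           - (-1) ^+ n * (p%:R - 1) ^+ 2 / (p%:R ^+ n * (p%:R + 1))
           + (-1) ^+ n / p%:R ^+ n * (p%:R - 1)
             * iota_np R n (padic_modp b1)) &
      forall b : 'F_p,
        iota_np R n b =
        (if ~~ (p %| n)%N then 0
         else if b != 0 then -1
         else p%:R - 1)].
Proof.
case: n n_ge2 mu mu_haar => [|[|k]] // _ mu' mu'_haar.
have b1E : `[< padic_dvd 1 b1 >] = (padic_modp b1 == 0).
  by apply/asboolP/eqP => /padic_dvd1E.
have p0 : p%:R != 0 :> R by rewrite pnatr_eq0 -lt0n prime_gt0.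
split.
- rewrite P_maxE // b1E !eqSS; case: (p == 2%N); rewrite ?andbF ?andbT.
    case: k mu' mu'_haar => [|k] mu' mu'_haar /=; last by rewrite div1r.
    by case: eqP => _ /=; field.
  by rewrite div1r.
- rewrite P0_sqfE // b1E !eqSS; case: (p == 2%N); rewrite ?andbF ?andbT.
    case: k mu' mu'_haar => [|k] mu' mu'_haar /=; last by rewrite div1r.
    by case: eqP => _ /=; ring.
  by rewrite div1r.
- exact: P1_sqf_char2.
- move=> podd; rewrite P1_sqf_odd // iota_npE // !eqSS.
  (* The density is real but iota is complex, so the identity is checked in [R[i]] after moving the
     embedding down to p. *)
  have pC0 : p%:R != 0 :> R[i] by rewrite pnatr_eq0 -lt0n prime_gt0.
  have pC1 : p%:R + 1 != 0 :> R[i] by rewrite natr1 pnatr_eq0.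
  case: k mu' mu'_haar => [|k] mu' mu'_haar /=.
    by rewrite mulr1 !(rmorphM, fmorphV, rmorphB, rmorphXn, rmorph_nat, rmorph1).
  by case: (p %| k.+3)%N; case: (padic_modp b1 == 0) => /=;
    rewrite !(rmorphM, rmorphD, fmorphV, rmorphB, rmorphXn, rmorphN, rmorph_nat,
              rmorph1, rmorph0) /= !exprS; field; rewrite ?expf_neq0 ?pC0 ?pC1.
- exact: iota_npE.
Qed.
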